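(* For $m\ge 3$, the number of thick diagrams of size $m$ is the Pell number $P_{m-2}$. For $m\ge1$, the number of non-mixed diagrams of size $m$ is $(3^{m-1}+1)/2$. Consequently, for $n\ge 2$, the number of pairs $(P,Q)$ of lattice paths of length $n$ with common endpoints, meeting only at their endpoints, such that the connected lattice path matroid $M[P,Q]$ on $[n]$ has no mixed pair of an initial and a final connected flat, is $(3^{n-2}+1)/2$.
   Context: Lattice paths consist of unit north ($N$) and east ($E$) steps starting at $(0,0)$. A diagram is the set of unit squares between two lattice paths $P$ (lower) and $Q$ (upper) with the same endpoints, $P$ strictly below $Q$ except at the endpoints; its size is the length of $P$ minus one. Writing $P=p_1\cdots p_n$, $Q=q_1\cdots q_n$ ending at $(m',r)$: $M[P,Q]$ is the transversal matroid on $[n]$ whose independent sets are the partial transversals of $(N_1,\ldots,N_r)$, where $N_i=\{l_i,\ldots,u_i\}$ with $l_i$, $u_i$ the positions of the $i$-th north step of $Q$, $P$ respectively. An initial connected flat is $[a]$ with $q_a=E$, $q_{a+1}=N$, with corner $(a_1,a_2)$ the meeting point of these steps; a final connected flat is $[b,n]$ with $p_{b-1}=N$, $p_b=E$, with corner $(b_1,b_2)$ the meeting point of these steps; such a pair is mixed if $a_1<b_1$ and $a_2>b_2$. The diagram is non-mixed if no such pair is mixed. A diagram is thick if it is non-mixed and every horizontal or vertical segment joining a point of $P$ to a point of $Q$ through the interior of the diagram has length at least $2$. Pell numbers: $P_0=0$, $P_1=1$, $P_{k+2}=2P_{k+1}+P_k$. *)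

(* Defs.v *)
From HB Require Import structures.
From mathcomp Require Import all_boot all_order all_algebra.
From mathcomp Require Import boolp classical_sets reals topology normedtype.

Set Implicit Arguments.
Unset Strict Implicit.
Unset Printing Implicit Defensive.

Import numFieldNormedType.Exports.

(* A lattice path of length n starting at (0,0) is the word of its steps.
   Step k (counted from 0 here, from 1 on paper) goes from vertex w k to
   vertex w k.+1. *)
Definition N : bool := true.
Definition E : bool := false.
Notation lpath n := (n.-tuple bool).

Definition vertex (w : seq bool) (k : nat) : nat * nat :=
  (count_mem E (take k w), count_mem N (take k w)).

(* Vertex k of any path lies on the line x + y = k, so two paths are compared
   by the heights of their vertices of equal index, and can only meet at
   vertices of equal index. *)
Definition strictly_below n (P Q : lpath n) : bool :=
  (vertex P n == vertex Q n) &&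
  [forall k : 'I_n, (0 < k) ==> ((vertex P k).2 < (vertex Q k).2)].

(* The unit square [i, i+1] x [j, j+1] is represented by (i, j). *)
Definition above_path (w : seq bool) (c : nat * nat) : Prop :=
  exists k, [/\ onth w k = Some E, (vertex w k).1 = c.1 & (vertex w k).2 <= c.2].
Definition below_path (w : seq bool) (c : nat * nat) : Prop :=
  exists k, [/\ onth w k = Some E, (vertex w k).1 = c.1 & c.2 < (vertex w k).2].

Definition squares n (PQ : lpath n * lpath n) : {set 'I_n * 'I_n} :=
  finset (fun c : 'I_n * 'I_n =>
    `[< above_path PQ.1 (c.1 : nat, c.2 : nat) /\
        below_path PQ.2 (c.1 : nat, c.2 : nat) >]).

(* The ground set [n] = {1, ..., n} is represented by 'I_n = {0, ..., n-1}. *)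
Section Flats.
Variables (n : nat) (P Q : lpath n).

(* On paper a = i+1, with q_a = E and q_(a+1) = N. *)
Definition initial_connected_flat (F : {set 'I_n}) : Prop :=
  exists i : nat, [/\ onth Q i = Some E, onth Q i.+1 = Some N &
    F = finset (fun k : 'I_n => k <= i)].

(* On paper b = j+2, with p_(b-1) = N and p_b = E. *)
Definition final_connected_flat (G : {set 'I_n}) : Prop :=
  exists j : nat, [/\ onth P j = Some N, onth P j.+1 = Some E &
    G = finset (fun k : 'I_n => j < k)].

(* The corner of F = [a] is the end of step a = #|F| of Q; the corner of
   G = [b, n] is the end of step b-1 = #|~: G| of P. *)
Definition initial_corner (F : {set 'I_n}) : nat * nat := vertex Q #|F|.
Definition final_corner (G : {set 'I_n}) : nat * nat := vertex P #|~: G|.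

Definition mixed_pair (F G : {set 'I_n}) : bool :=
  ((initial_corner F).1 < (final_corner G).1) &&
  ((final_corner G).2 < (initial_corner F).2).

Definition non_mixed : Prop :=
  forall F G, initial_connected_flat F -> final_connected_flat G ->
    ~~ mixed_pair F G.

End Flats.

Section Thick.
Local Open Scope ring_scope.
Variable R : realType.

Definition on_path (w : seq bool) : set (R * R) :=
  fun z => exists k, exists2 t : R, 0 <= t <= 1 &
    (onth w k = Some E /\
       z = ((vertex w k).1%:R + t, (vertex w k).2%:R)) \/
    (onth w k = Some N /\
       z = ((vertex w k).1%:R, (vertex w k).2%:R + t)).

Definition region n (PQ : lpath n * lpath n) : set (R * R) :=
  fun z => exists2 c, c \in squares PQ &
    (c.1%:R <= z.1 <= c.1%:R + 1) /\ (c.2%:R <= z.2 <= c.2%:R + 1).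

(* Every point of the segment [u, v] other than u and v is an interior point
   of the diagram.  As points of the paths are never interior, this excludes
   the degenerate case u = v for u on both paths. *)
Definition through_interior n (PQ : lpath n * lpath n) (u v : R * R) : Prop :=
  forall t : R, 0 < t < 1 ->
    interior (region PQ) (u.1 + t * (v.1 - u.1), u.2 + t * (v.2 - u.2)).

Definition thick n (P Q : lpath n) : Prop :=
  non_mixed P Q /\
  forall u v : R * R, on_path P u -> on_path Q v ->
    through_interior (P, Q) u v ->
    (u.2 = v.2 -> 2 <= `|u.1 - v.1|) /\ (u.1 = v.1 -> 2 <= `|u.2 - v.2|).

End Thick.

(* A diagram of size m is a set of squares; it has paths of length m+1. *)
Definition non_mixed_diagrams (m : nat) : {set {set 'I_m.+1 * 'I_m.+1}} :=
  @squares m.+1 @: finset (fun PQ : lpath m.+1 * lpath m.+1 =>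
    strictly_below PQ.1 PQ.2 && `[< non_mixed PQ.1 PQ.2 >]).

Definition thick_diagrams (R : realType) (m : nat) :
    {set {set 'I_m.+1 * 'I_m.+1}} :=
  @squares m.+1 @: finset (fun PQ : lpath m.+1 * lpath m.+1 =>
    strictly_below PQ.1 PQ.2 && `[< thick R PQ.1 PQ.2 >]).

(* Pairs P (lower), Q (upper) as required to define M[P,Q], with common
   endpoints and meeting only there. *)
Definition meet_only_at_ends n (P Q : lpath n) : bool :=
  [&& vertex P n == vertex Q n,
      [forall k : 'I_n, (vertex P k).2 <= (vertex Q k).2] &
      [forall k : 'I_n, (0 < k) ==> (vertex P k != vertex Q k)]].

(* A matroid on T is represented by its family of independent sets. *)
Section Matroid.
Variables (n : nat) (P Q : lpath n).

Definition north_step (w : seq bool) (i : nat) : nat :=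
  nth n [seq k <- iota 0 n | onth w k == Some N] i.

(* Here N_i has index i = 0, ..., r-1. *)
Definition north_interval (i : nat) : {set 'I_n} :=
  finset (fun k : 'I_n => north_step Q i <= k <= north_step P i).

Definition lpm : {set {set 'I_n}} :=
  finset (fun X : {set 'I_n} => `[< exists f : 'I_n -> nat,
    {in X &, injective f} /\
    {in X, forall k, f k < (vertex P n).2 /\ k \in north_interval (f k)} >]).

End Matroid.

(* A matroid is connected when it is not the direct sum of two matroids on
   nonempty ground sets. *)
Definition matroid_connected (T : finType) (I : {set {set T}}) : Prop :=
  ~ exists A : {set T}, [/\ A != finset.set0, ~: A != finset.set0 &
      forall X : {set T}, (X \in I) = (X :&: A \in I) && (X :\: A \in I)].

Definition non_mixed_path_pairs (n : nat) : {set lpath n * lpath n} :=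
  finset (fun PQ : lpath n * lpath n =>
    meet_only_at_ends PQ.1 PQ.2 && `[< non_mixed PQ.1 PQ.2 >]).

Fixpoint pell (k : nat) : nat :=
  match k with
  | 0 => 0
  | 1 => 1
  | (k'.+1 as k1).+1 => 2 * pell k1 + pell k'
  end.

(* Main.v *)
Require Import Defs.
From mathcomp Require Import all_boot all_order all_algebra.
From mathcomp Require Import reals.
From mathcomp Require Import boolp topology normedtype.
From mathcomp Require Import zify lra.

(** Two non-crossing paths form a non-mixed diagram exactly when no east-north
    corner of the upper path Q lies strictly north-west of a north-east corner
    of the lower path P.  This condition survives the removal of the first
    column (the first E of both words) or of the first row (the first N of both
    words), provided these steps are doubled.  A diagram of which neither can be
    removed this way starts with a single cell standing out to the left
    (Q = NEN...) or below (P = ENE...), and cutting this cell off leaves a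
    smaller diagram.  The resulting recurrences are solved by (3^k + 1) / 2.

    A diagram is thick exactly when stripping the first and the last step of
    both paths leaves non-crossing paths whose corners satisfy the weak form of
    the non-mixedness condition.  The same peeling then gives the Pell
    recurrence.

    The squares (i, j) of a diagram on the antidiagonal i + j = k are those with
    x_Q(k+1) <= i < x_P(k+1), so the diagram determines its paths.

    M[P,Q] is connected since consecutive elements k, k+1 of the ground set are
    exchangeable: some X has X + k and X + (k+1) as bases. *)

Set Implicit Arguments.
Unset Strict Implicit.
Unset Printing Implicit Defensive.

(** * Words, corners and admissible pairs *)

Definition flip (w : seq bool) : seq bool := map negb w.

Lemma flipK : involutive flip.
Proof. by move=> w; rewrite /flip -map_comp map_id_in // => b _ /=; rewrite negbK. Qed.

Lemma size_flip w : size (flip w) = size w.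
Proof. exact: size_map. Qed.

Lemma vertex_flip w k : vertex (flip w) k = ((vertex w k).2, (vertex w k).1).
Proof.
rewrite /vertex /flip -map_take !count_map /=.
by congr pair; apply: eq_count => -[].
Qed.

Lemma vertexD w k : (vertex w k).1 + (vertex w k).2 = minn k (size w).
Proof.
rewrite -size_take_min /= addnC -(count_predC (pred1 N)).
by congr addn; apply: eq_count => -[].
Qed.

Lemma vertex0 w : vertex w 0 = (0, 0).
Proof. by rewrite /vertex take0. Qed.

Lemma vertexS b w k :
  vertex (b :: w) k.+1 = (~~ b + (vertex w k).1, b + (vertex w k).2).
Proof. by rewrite /vertex /=; case: b. Qed.

Lemma vertex_oversize w k : size w <= k -> vertex w k = vertex w (size w).
Proof. by move=> le_wk; rewrite /vertex !take_oversize. Qed.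

Lemma vertex_size w : vertex w (size w) = (count_mem E w, count_mem N w).
Proof. by rewrite /vertex take_size. Qed.

Lemma vertex2E w k : (vertex w k).2 = count_mem N (take k w).
Proof. by []. Qed.

Lemma vertex1_mono w k l : k <= l -> (vertex w k).1 <= (vertex w l).1.
Proof. by move=> /subnKC <-; rewrite /vertex takeD /= count_cat leq_addr. Qed.

Lemma vertex2_mono w k l : k <= l -> (vertex w k).2 <= (vertex w l).2.
Proof. by move=> /subnKC <-; rewrite /vertex takeD /= count_cat leq_addr. Qed.

Local Opaque vertex.

Lemma vertexSr w k b : onth w k = Some b ->
  vertex w k.+1 = ((vertex w k).1 + ~~ b, (vertex w k).2 + b).
Proof.
elim: w k => [|c w IHw] [|k] //=.
  by move=> [<-]; rewrite vertexS !vertex0 /= !addn0.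
by move=> /IHw; rewrite !vertexS => -> /=; rewrite !addnA.
Qed.

Lemma onth_size (w : seq bool) k b : onth w k = Some b -> k < size w.
Proof. by elim: w k => [|c w IHw] [|k] //= /IHw. Qed.

Lemma onth_lt (w : seq bool) k : k < size w -> exists b, onth w k = Some b.
Proof. by elim: w k => [|c w IHw] [|k] //= ; [exists c | exact: IHw]. Qed.

Lemma onth_flip w k b : onth (flip w) k = Some b <-> onth w k = Some (~~ b).
Proof.
elim: w k => [|c w IHw] [|k] //=.
by split=> -[]; [move=> <- | move=> ->]; rewrite negbK.
Qed.

(* [d] is the current height of the upper path over the lower one. *)
Fixpoint below (d : nat) (p q : seq bool) : bool :=
  match p, q with
  | [::], [::] => d == 0
  | b :: p', c :: q' => (0 < d) && below (d + c - b) p' q'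
  | _, _ => false
  end.

(** The recursive form of [strictly_below] for words of length at least 2: the first steps are
    forced and leave height difference 1, which then stays positive up to the end. On shorter words
    it is false. *)
Definition strict (p q : seq bool) : bool :=
  match p, q with
  | b :: p', c :: q' => [&& ~~ b, c & below 1 p' q']
  | _, _ => false
  end.

Lemma belowP d p q : size p = size q ->
  reflect (d + (vertex q (size q)).2 = (vertex p (size p)).2 /\
           forall k, k < size p -> (vertex p k).2 < d + (vertex q k).2)
          (below d p q).
Proof.
elim: p q d => [|b p IHp] [|c q] //= d.
  by move=> _; rewrite !vertex0 addn0; apply: (iffP eqP) => [->|[]].
move=> [/[dup] spq /IHp {}IHp]; apply: (iffP andP) => [[d0 /IHp[e h]]|[e h]].
  split; first by rewrite !vertexS /=; lia.
  move=> [|k]; first by rewrite !vertex0; lia.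
  by rewrite ltnS => /h; rewrite !vertexS /=; lia.
have d0 : 0 < d by have := h 0 isT; rewrite !vertex0; lia.
split=> //; apply/IHp; split; first by move: e; rewrite !vertexS /=; lia.
by move=> k kp; have := h k.+1 kp; rewrite !vertexS /=; lia.
Qed.

Lemma below_size d p q : below d p q -> size p = size q.
Proof. by elim: p q d => [|b p IHp] [|c q] //= d /andP[_ /IHp ->]. Qed.

Lemma strict_size p q : strict p q -> size p = size q.
Proof. by case: p q => [|b p] [|c q] //= /and3P[_ _ /below_size ->]. Qed.

Lemma strictP p q : size p = size q -> 1 < size p ->
  reflect ((vertex p (size p)).2 = (vertex q (size q)).2 /\
    forall k, 0 < k < size p -> (vertex p k).2 < (vertex q k).2)
  (strict p q).
Proof.
case: p q => [|b p] [|c q] //= [spq]; rewrite ltnS => p0.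
apply: (iffP and3P) => [[nb cc /(belowP _ spq)[e h]]|[e h]].
  split; first by rewrite !vertexS /=; move: nb cc e; case: b c => [] [] //; lia.
  by move=> [|k] //; rewrite !ltnS /= => /h; rewrite !vertexS /=; move: nb cc;
    case: b c => [] [] //; lia.
have := h 1 p0; rewrite !vertexS !vertex0 /= !addn0.
case: b c e h => [] [] // e h _; split=> //; apply/(belowP _ spq).
move: e; rewrite !vertexS /= => e; split; first lia.
by move=> k kp; have := h k.+1 kp; rewrite !vertexS /=; lia.
Qed.

(** Reflection in the diagonal swaps the two paths and keeps their distance. All statements about
    rows are derived from those about columns, or conversely, through this symmetry. *)
Lemma below_flip d p q : below d (flip q) (flip p) = below d p q.
Proof.
elim: p q d => [|b p IHp] [|c q] //= d.
case: (posnP d) => //= d0; rewrite -IHp.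
by congr below; case: b c => [] [] /=; lia.
Qed.

Lemma strict_flip p q : strict (flip q) (flip p) = strict p q.
Proof. by case: p q => [|b p] [|c q] //=; rewrite below_flip negbK andbCA. Qed.

(* Inserting E into both words: the lower path is delayed by one step, whose
   letter [b] accounts for the change of height. *)
Lemma below_insert_E g (b : bool) p k q : 0 < g ->
  below (g + b) (b :: p) (nseq k N ++ E :: q) = below g p (nseq k N ++ q).
Proof.
elim: k g b p => [|k IHk] g b p g0 /=.
  by rewrite addn_gt0 g0 addn0 addnK.
rewrite addn_gt0 g0 /= addn1; have -> : (g + b).+1 - b = g.+1 by lia.
case: p => [|c p]; first by case: (nseq k N).
rewrite -addn1.
have -> : g + 1 = (g + 1 - c) + c by lia.
by rewrite IHk /= ?g0 //; lia.
Qed.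

(** The default [E] of [head] ensures that a final east step produces no corner. *)
Fixpoint en_corners_from (x y : nat) (w : seq bool) : seq (nat * nat) :=
  match w with
  | [::] => [::]
  | true :: w' => en_corners_from x y.+1 w'
  | false :: w' =>
    if head E w' then (x.+1, y) :: en_corners_from x.+1 y w'
    else en_corners_from x.+1 y w'
  end.

Definition en_corners := en_corners_from 0 0.

Definition swap (a : nat * nat) : nat * nat := (a.2, a.1).

Definition ne_corners (w : seq bool) : seq (nat * nat) :=
  map swap (en_corners (flip w)).

Definition move_by (x y : nat) (a : nat * nat) : nat * nat := (x + a.1, y + a.2).

Lemma en_corners_fromE x y w :
  en_corners_from x y w = map (move_by x y) (en_corners w).
Proof.
suff gen x' y' : en_corners_from (x + x') (y + y') w =
    map (move_by x y) (en_corners_from x' y' w) by rewrite -gen !addn0.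
elim: w x' y' => [|[] w IHw] //= x' y'; first by rewrite -addnS IHw.
by case: ifP => _; rewrite -addnS IHw.
Qed.

Lemma en_cornersN w : en_corners (N :: w) = map (move_by 0 1) (en_corners w).
Proof. exact: (en_corners_fromE 0 1). Qed.

Lemma en_cornersEE w :
  en_corners (E :: E :: w) = map (move_by 1 0) (en_corners (E :: w)).
Proof. exact: (en_corners_fromE 1 0 (E :: w)). Qed.

Lemma en_cornersEN w : en_corners (E :: N :: w) =
  (1, 0) :: map (move_by 1 0) (en_corners (N :: w)).
Proof. by rewrite -en_corners_fromE. Qed.

Lemma ne_cornersE w : ne_corners (E :: w) = map (move_by 1 0) (ne_corners w).
Proof. by rewrite /ne_corners /= en_cornersN -!map_comp. Qed.

Lemma mem_en_corners w a : reflect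
  (exists k, [/\ onth w k = Some E, onth w k.+1 = Some N & a = vertex w k.+1])
  (a \in en_corners w).
Proof.
elim: w a => [|b w IHw] a; first by constructor=> -[k []]; rewrite onth0n.
have ext k : vertex (b :: w) k.+1 = move_by (~~ b) b (vertex w k) by rewrite vertexS.
have step s : s = map (move_by (~~ b) b) (en_corners w) ->
    reflect (exists k, [/\ onth (b :: w) k.+1 = Some E,
      onth (b :: w) k.+2 = Some N & a = vertex (b :: w) k.+2])
      (a \in s).
  move=> ->; apply: (iffP mapP) => [[c /IHw[k [h1 h2 ->]] ->]|[k [h1 h2 ->]]].
    by exists k; rewrite ext.
  by exists (vertex w k.+1); [apply/IHw; exists k | rewrite ext].
(* [h] treats the words whose first step starts no corner: it is [N], or no [N] follows it. All
   corners are then shifted corners of the tail. *)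
have h s : s = map (move_by (~~ b) b) (en_corners w) ->
    (onth w 0 <> Some N \/ b = N) -> reflect
  (exists k, [/\ onth (b :: w) k = Some E,
    onth (b :: w) k.+1 = Some N & a = vertex (b :: w) k.+1])
  (a \in s).
  move=> /step {}step nw; apply: (iffP step) => [[k hk]|[[|k] [h1 h2 h3]]].
  - by exists k.+1.
  - by case: nw h1 h2 => [//|->].
  - by exists k.
case: b ext step h => ext step h; first by apply: h (en_cornersN _) _; right.
case: w IHw ext step h => [|[] w] IHw ext step h.
- by apply: h => //; left.
- rewrite en_cornersEN in_cons; apply: (iffP orP) =>
  [[/eqP->|/step[//|k hk]]|[[|k] [h1 h2 h3]]].
  + by exists 0; rewrite !vertexS !vertex0.
  + by exists k.+1.
  + by left; rewrite h3 !vertexS vertex0.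
  + by right; apply/step => //; exists k.
- by apply: h; [exact: en_cornersEE | left].
Qed.

Lemma mem_ne_corners w a : reflect
  (exists k, [/\ onth w k = Some N, onth w k.+1 = Some E & a = vertex w k.+1])
  (a \in ne_corners w).
Proof.
have -> : (a \in ne_corners w) = (swap a \in en_corners (flip w)).
  by rewrite -[a in LHS](_ : swap (swap a) = a) ?mem_map //; [case=> ? ? [] ? ? [] ->
    -> | case: a].
apply: (iffP (mem_en_corners _ _)) => -[k [h1 h2 h3]]; exists k; split.
- exact/(onth_flip _ _ E).
- exact/(onth_flip _ _ N).
- by move: h3; rewrite vertex_flip; case: a => ? ? [-> ->]; case: vertex.
- exact/(onth_flip _ _ E).
- exact/(onth_flip _ _ N).
- by rewrite vertex_flip h3.
Qed.

(* [e = 0] is the relation of the context; [e = 1] is the weak version, with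
   both inequalities non-strict. *)
Definition mixed (e : nat) (a b : nat * nat) : bool :=
  (a.1 < b.1 + e) && (b.2 < a.2 + e).

Definition unmixed (e : nat) (p q : seq bool) : bool :=
  allrel (fun a b => ~~ mixed e a b) (en_corners q) (ne_corners p).

Lemma unmixed_flip e p q : unmixed e (flip q) (flip p) = unmixed e p q.
Proof.
rewrite /unmixed /ne_corners flipK allrel_mapr allrelC allrel_mapr.
by apply: eq_allrel => a b; rewrite /mixed /= andbC.
Qed.

(** The predicate that is counted: [e = 0] describes non-mixed diagrams, [e = 1] thick diagrams
    stripped of the first and last steps of both paths. *)
Definition admissible (e : nat) (p q : seq bool) : bool :=
  strict p q && unmixed e p q.

Lemma admissible_flip e p q :
  admissible e (flip q) (flip p) = admissible e p q.
Proof. by rewrite /admissible strict_flip unmixed_flip. Qed.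

(** * Counting admissible pairs *)

Lemma strict_N p q : strict p q -> count_mem N p = count_mem N q.
Proof.
suff h d p' q' : below d p' q' -> d + count_mem N q' = count_mem N p'.
  by case: p q => [|[] p] [|[] q] //= /h.
elim: p' q' d => [|b p' IHp] [|c q'] //= d; first by move/eqP->.
by move=> /andP[d0 /IHp]; case: b c => [] [] /=; lia.
Qed.

(** Applied to both words, [dup E] inserts a first column and [dup N] a first row. Appending [c] to
    a word without [c] makes [dupK] unconditional. *)
Fixpoint dup (c : bool) (w : seq bool) : seq bool :=
  match w with
  | [::] => [:: c]
  | x :: w' => if x == c then c :: w else x :: dup c w'
  end.

(** Recognises the image under [dup c] of the words containing [c], that is, the words from which a
    [c] can be removed reversibly. *)
Fixpoint doubled (c : bool) (w : seq bool) : bool :=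
  match w with
  | [::] => false
  | x :: w' => if x == c then ohead w' == Some c else doubled c w'
  end.

Lemma dupK c : cancel (dup c) (rem c).
Proof.
elim=> [|x w IHw] /=; first by rewrite eqxx.
by case: ifP => xc /=; rewrite ?eqxx // xc IHw.
Qed.

Lemma remK c w : doubled c w -> dup c (rem c w) = w.
Proof.
elim: w => [|x w IHw] //=; case: ifP => [/eqP->|xc /IHw] /=; last by rewrite xc => ->.
by clear IHw; case: w => //= y w /eqP[->]; rewrite eqxx.
Qed.

Lemma doubled_dup c w : c \in w -> doubled c (dup c w).
Proof.
elim: w => [|x w IHw] //=; rewrite in_cons eq_sym; case: ifP => [/eqP->|xc] //=.
  by rewrite eqxx.
by rewrite xc.
Qed.

Lemma size_dup c w : size (dup c w) = (size w).+1.
Proof. by elim: w => //= x w IHw; case: ifP => //= _; rewrite IHw. Qed.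

Lemma dup_flip c w : dup c (flip w) = flip (dup (~~ c) w).
Proof.
elim: w => [|x w IHw] /=; first by rewrite negbK.
by rewrite IHw; clear IHw; case: x c => [] [].
Qed.

Lemma doubled_flip c w : doubled c (flip w) = doubled (~~ c) w.
Proof. by elim: w => [|x w IHw] //=; rewrite IHw; clear IHw; case: w x c =>
  [|[] w] [] []. Qed.

Lemma mem_flip c w : (c \in flip w) = (~~ c \in w).
Proof. by elim: w => [|x w IHw] //=; rewrite !in_cons IHw; clear IHw; case: x c =>
  [] []. Qed.

(** Doubling puts an [E] in front of [p], but in [q] only after the initial run of [N]; along this
    run the lower path is merely delayed, which is [below_insert_E] with height difference 1. *)
Lemma dup_strict_E p q : head N p = E -> head E q = N -> E \in q ->
  strict (dup E p) (dup E q) = strict p q.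
Proof.
case: p q => [|[] p] [|[] q] //= _ _; rewrite in_cons /= => qE.
have [k [q1 ->]] : exists k q1, q = nseq k N ++ E :: q1.
  elim: q qE => [|[] q IHq] // qE; last by exists 0, q.
  by have [k [q1 ->]] := IHq qE; exists k.+1, q1.
have -> : dup E (nseq k N ++ E :: q1) = nseq k N ++ [:: E, E & q1].
  by elim: k => //= k ->.
exact: (@below_insert_E 1 E).
Qed.

(** All corners come after the first [E], and doubling it creates no new one, so each corner moves
    one unit to the right. *)
Lemma en_corners_dupE w :
  en_corners (dup E w) = map (move_by 1 0) (en_corners w).
Proof.
rewrite -en_corners_fromE /en_corners.
by elim: w 0 {1 3}0 => [|[] w IHw] //= x y.
Qed.

Lemma mixed_shift e x y a b :
  mixed e (move_by x y a) (move_by x y b) = mixed e a b.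
Proof. by rewrite /mixed /= -!addnA !ltn_add2l. Qed.

Lemma allrel_mixed_shift e x y s t :
  allrel (fun a b => ~~ mixed e a b) (map (move_by x y) s) (map (move_by x y) t) =
  allrel (fun a b => ~~ mixed e a b) s t.
Proof.
rewrite allrel_mapl allrel_mapr.
by apply: eq_allrel => a b; rewrite mixed_shift.
Qed.

(** Mixedness depends only on the relative position of two corners, and the corners of both paths
    move by the same vector. *)
Lemma dup_admissible_E e p q : head N p = E -> head E q = N -> E \in q ->
  admissible e (dup E p) (dup E q) = admissible e p q.
Proof.
move=> hp hq qE; rewrite /admissible dup_strict_E //; congr (_ && _).
rewrite /unmixed en_corners_dupE.
by case: p hp => [|[] p] //= _; rewrite ne_cornersE allrel_mixed_shift.
Qed.

Lemma dup_admissible_N e p q : head N p = E -> head E q = N -> N \in p ->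
  admissible e (dup N p) (dup N q) = admissible e p q.
Proof.
move=> hp hq pN; rewrite -admissible_flip -[RHS]admissible_flip.
rewrite -!(dup_flip E) dup_admissible_E ?mem_flip //.
  by case: q hq => [|[]].
by case: p hp pN => [|[]].
Qed.

Lemma strict_heads p q : strict p q -> [/\ head N p = E & head E q = N].
Proof. by case: p q => [|[] p] [|[] q]. Qed.

Lemma strict_has_N p q : strict p q -> N \in p.
Proof.
move=> s; rewrite -has_pred1 has_count (strict_N s).
by case: p q s => [|[] p] [|[] q].
Qed.

(** * Cardinalities of sets of pairs of words of a given length *)

Definition cnt (n : nat) (X : seq bool -> seq bool -> bool) : nat :=
  #|[set w : n.-tuple bool * n.-tuple bool | X w.1 w.2]|.

Lemma eq_cnt n X Y :
  (forall p q, size p = n -> size q = n -> X p q = Y p q) -> cnt n X = cnt n Y.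
Proof.
by move=> e; apply: eq_card => -[p q]; rewrite !inE /= e ?size_tuple.
Qed.

Lemma cnt_split n Y X : cnt n X =
  cnt n (fun p q => X p q && Y p q) + cnt n (fun p q => X p q && ~~ Y p q).
Proof.
rewrite /cnt -(cardsID [set w | Y (tval w.1) (tval w.2)] [set w | X _ _]).
by congr (_ + _); apply: eq_card => w; rewrite !inE // andbC.
Qed.

Lemma leq_cnt n m (X Y : seq bool -> seq bool -> bool)
    (f g f1 g1 : seq bool -> seq bool) :
  (forall p q, size p = n -> size q = n -> X p q ->
     [/\ size (f p) = m, size (g q) = m, Y (f p) (g q), f1 (f p) = p & g1 (g q) = q]) ->
  cnt n X <= cnt m Y.
Proof.
(* The default tuple is never taken on pairs satisfying [X], whose images have length [m]. *)
move=> h; pose F (w : n.-tuple bool * n.-tuple bool) : m.-tuple bool * m.-tuple bool :=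
  (insubd [tuple of nseq m N] (f w.1), insubd [tuple of nseq m N] (g w.2)).
have FE w : w \in [set w : n.-tuple bool * n.-tuple bool | X w.1 w.2] ->
  (tval (F w).1 = f w.1) * (tval (F w).2 = g w.2).
  rewrite inE => /h[]; rewrite ?size_tuple // => s1 s2 _ _ _.
  by rewrite /F /= !val_insubd s1 s2 eqxx.
rewrite /cnt -(@card_in_imset _ _ F) => [|w v wX vX e].
  apply/subset_leq_card/subsetP => _ /imsetP[w wX ->]; rewrite inE !FE //.
  by move: wX; rewrite inE => /h[]; rewrite ?size_tuple.
have e1 := congr1 (fun z => tval z.1) e; have e2 := congr1 (fun z => tval z.2) e.
move: e1 e2; rewrite /= !FE // => e1 e2.
move: wX vX; rewrite !inE => /h[]; rewrite ?size_tuple // => _ _ _ w1 w2.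
move=> /h[]; rewrite ?size_tuple // => _ _ _ v1 v2.
have E1 : w.1 = v.1 by apply: val_inj; rewrite -[LHS]w1 -[RHS]v1 e1.
have E2 : w.2 = v.2 by apply: val_inj; rewrite -[LHS]w2 -[RHS]v2 e2.
by rewrite [w]surjective_pairing [v]surjective_pairing E1 E2.
Qed.

Lemma cnt_bij n m (X Y : seq bool -> seq bool -> bool)
    (f g f1 g1 : seq bool -> seq bool) :
  (forall p q, size p = n -> size q = n -> X p q ->
     [/\ size (f p) = m, size (g q) = m, Y (f p) (g q), f1 (f p) = p & g1 (g q) = q]) ->
  (forall p q, size p = m -> size q = m -> Y p q ->
     [/\ size (f1 p) = n, size (g1 q) = n, X (f1 p) (g1 q),
       f (f1 p) = p & g (g1 q) = q]) ->
  cnt n X = cnt m Y.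
Proof. by move=> /leq_cnt h1 /leq_cnt h2; apply/eqP; rewrite eqn_leq h1 h2. Qed.

Lemma cnt_flip n X : cnt n (fun p q => X (flip q) (flip p)) = cnt n X.
Proof.
suff le Y : cnt n (fun p q => Y (flip q) (flip p)) <= cnt n Y.
  apply/eqP; rewrite eqn_leq le /=; apply: leq_trans (le _).
  by rewrite (@eq_cnt _ X (fun p q => X (flip (flip p)) (flip (flip q)))) // =>
    p q _ _; rewrite !flipK.
pose F (w : n.-tuple bool * n.-tuple bool) : n.-tuple bool * n.-tuple bool :=
  ([tuple of map negb w.2], [tuple of map negb w.1]).
rewrite /cnt -(@card_imset _ _ F) => [|[p q] [p' q'] [e1 e2]].
  by apply/subset_leq_card/subsetP => _ /imsetP[w wX ->]; move: wX; rewrite !inE.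
by congr pair; apply: val_inj; apply: (inj_map negb_inj).
Qed.

(* The first column (row) of the diagram can be removed. *)
Definition col (p q : seq bool) := doubled E p && doubled E q.
Definition row (p q : seq bool) := doubled N p && doubled N q.

(** Deleting the first [N] of both words is a bijection inverse to [dup N]; any further condition
    that is insensitive to the doubling is carried along. *)
Lemma cnt_row e n Y :
  (forall p q, N \in p -> N \in q -> Y (dup N p) (dup N q) = Y p q) ->
  cnt n.+1 (fun p q => [&& admissible e p q, row p q & Y p q]) =
  cnt n (fun p q => admissible e p q && Y p q).
Proof.
move=> hY; apply: (@cnt_bij _ _ _ _ (rem N) (rem N) (dup N) (dup N)) => p q sp sq.
  case/and3P=> a /andP[dp dq] y.
  have mem w : doubled N w -> N \in rem N w.
    elim: w => [|[] w IHw] //=; first by clear IHw; case: w => [|[] w] //=;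
      rewrite in_cons.
  have mem' w : doubled N w -> N \in w by move=> /mem /mem_rem.
  have [hp hq] := strict_heads (proj1 (andP a)).
  have hp' : head N (rem N p) = E by case: (p) hp => [|[]].
  have hq' : head E (rem N q) = N by case: (q) hq dq => [|[] [|[]]].
  rewrite !remK // !size_rem ?mem' // sp sq; split=> //.
  by rewrite -dup_admissible_N ?mem // !remK // a -hY ?mem // !remK.
case/andP=> a y; have [hp hq] := strict_heads (proj1 (andP a)).
have pN := strict_has_N (proj1 (andP a)).
have qN : N \in q by case: (q) hq => [|[] q'] //= _; rewrite in_cons.
rewrite !size_dup sp sq !dupK; split=> //.
by rewrite dup_admissible_N // a hY // y /row !doubled_dup.
Qed.

Lemma cnt_col e n :
  cnt n.+1 (fun p q => admissible e p q && col p q) = cnt n (admissible e).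
Proof.
rewrite -cnt_flip (@eq_cnt _ _ (fun p q => [&& admissible e p q, row p q & true])).
  by rewrite cnt_row //; apply: eq_cnt => p q _ _; rewrite andbT.
move=> p q _ _; rewrite admissible_flip andbT; congr (_ && _).
by rewrite /col !doubled_flip andbC.
Qed.

Definition pre (u w : seq bool) := take (size u) w == u.

Lemma doubled_E_dup_N w : N \in w -> doubled E (dup N w) = doubled E w.
Proof. by case: w => [|[] [|[] w]]. Qed.

(** Removing a first row does not affect whether the first column can be removed. *)
Lemma cnt_nocol_row e n :
  cnt n.+1 (fun p q => [&& admissible e p q, row p q & ~~ col p q]) =
  cnt n (fun p q => admissible e p q && ~~ col p q).
Proof.
by apply: cnt_row => p q pN qN; rewrite /col !doubled_E_dup_N.
Qed.

Lemma not_doubled_E q : head E q = N -> ~~ doubled E q ->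
  [\/ exists k, exists q', q = nseq k.+1 N ++ E :: N :: q',
      exists k, q = nseq k.+1 N ++ [:: E] | exists k, q = nseq k.+1 N].
Proof.
case: q => [|[] q] // _ /=.
elim: q => [|[] q IHq] /=; first by constructor 3; exists 0.
  move=> /IHq[[k [q' [->]]]|[k [->]]|[k [->]]].
  - by constructor 1; exists k.+1, q'.
  - by constructor 2; exists k.+1.
  - by constructor 3; exists k.+1.
case: q {IHq} => [|[] q] //= _; first by constructor 2; exists 0.
by constructor 1; exists 0, q.
Qed.

Lemma en_corners_nseqN k w :
  en_corners (nseq k N ++ w) = map (move_by 0 k) (en_corners w).
Proof.
elim: k => [|k IHk]; first by rewrite map_id_in // => -[].
by rewrite /= en_cornersN IHk -map_comp; apply: eq_map => a; rewrite /move_by /= !add0n.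
Qed.

(** The word [p] starts with two [E], so [q] contains at least two as well. Its first [E] is not
    followed by [E], hence by [N], and this makes a corner above the initial run of [k + 1] north
    steps. *)
Lemma corner_of_not_doubled p q : strict p q -> 2 < size p ->
  ~~ doubled E q -> doubled E p ->
  exists2 k, (1, k.+1) \in en_corners q & head E (behead q) = (0 < k).
Proof.
move=> s sp dq dp; have [hp hq] := strict_heads s.
have eqN := strict_N s; have eqs := strict_size s.
have eqE : count_mem E p = count_mem E q.
  have cE w : count_mem E w = size w - count_mem N w.
    by rewrite -(count_predC (pred1 N) w) addKn; apply: eq_count => -[].
  by rewrite !cE eqN eqs.
have two : 1 < count_mem E p.
  by case: (p) hp dp => [|[] [|[] p']].
have cN k : count_mem E (nseq k N) = 0 by rewrite count_nseq mul0n.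
case: (not_doubled_E hq dq) => [[k [q' e]]|[k e]|[k e]].
- exists k; last by rewrite e; case: k {e}.
  rewrite e en_corners_nseqN en_cornersEN; apply/mapP.
  by exists (1, 0); rewrite ?in_cons ?eqxx // /move_by /= addn0.
- by move: two; rewrite eqE e count_cat cN.
- by move: two; rewrite eqE e cN.
Qed.

Lemma corner_of_not_doubled_N p q : strict p q -> 2 < size p ->
  ~~ doubled N p -> doubled N q ->
  exists2 k, (k.+1, 1) \in ne_corners p & head N (behead p) = ~~ (0 < k).
Proof.
move=> s sp dp dq.
have [||||k kc kh] := @corner_of_not_doubled (flip q) (flip p).
- by rewrite strict_flip.
- by rewrite size_flip -(strict_size s).
- by rewrite doubled_flip.
- by rewrite doubled_flip.
exists k; first by apply/mapP; exists (1, k.+1).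
by rewrite -kh; case: (p) sp => [|b [|c p']] //= _; rewrite negbK.
Qed.

(** Four cases, by whether [p] starts with [EE] and [q] with [NN]. If both do, the first corners of
    the two paths form a mixed pair. If neither does, the paths meet at (1, 1). If exactly one does,
    the third letter of the other word is forced. *)
Lemma minimal_start e p q : admissible e p q -> 2 < size p ->
  ~~ col p q -> ~~ row p q -> pre [:: E; N; E] p || pre [:: N; E; N] q.
Proof.
move=> /andP[s u] sp nc nr; have [hp hq] := strict_heads s.
have sq : 2 < size q by rewrite -(strict_size s).
have [dEp|dEp] := boolP (doubled E p); have [dNq|dNq] := boolP (doubled N q).
- have dEq : ~~ doubled E q by move: nc; rewrite /col dEp.
  have dNp : ~~ doubled N p by move: nr; rewrite /row dNq andbT.
  have [k kc kh] := corner_of_not_doubled s sp dEq dEp.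
  have [j jc jh] := corner_of_not_doubled_N s sp dNp dNq.
  have k0 : 0 < k by rewrite -kh; case: (q) dNq sq hq => [|[] [|[] q']].
  have j0 : 0 < j.
    by move: jh; case: (p) dEp sp hp => [|[] [|[] p']] //= _ _ _; case: j {jc}.
  by move/allrelP: u => /(_ _ _ kc jc); rewrite /mixed /= !addSn !ltnS !addn_gt0 k0 j0.
- by apply/orP; right; case: (p) (q) s sp sq dNq dEp nc =>
  [|[] [|[] [|b p']]] [|[] [|[] [|[] q']]] //; rewrite /pre /= take0.
- by apply/orP; left; case: (p) (q) s sp sq dNq dEp nr =>
  [|[] [|[] [|[] p']]] [|[] [|[] [|b q']]] //; rewrite /pre /= take0.
- by case: (p) (q) s sp sq dNq dEp => [|[] [|[] [|[] p']]] [|[] [|[] [|[] q']]].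
Qed.

(* Pairs whose first column is a single cell that forms a corner of Q. *)
Definition notch e n := cnt n (fun p q => admissible e p q && pre [:: N; E; N] q).

(** The starts [NEN] of the upper and [ENE] of the lower path are reflections of each other. They
    exclude one another, since with both the paths would meet at (1, 1). *)
Lemma cnt_nocol_norow e n : 2 < n ->
  cnt n (fun p q => [&& admissible e p q, ~~ col p q & ~~ row p q]) =
  2 * notch e n.
Proof.
move=> n2; rewrite (cnt_split _ (fun _ q => pre [:: N; E; N] q)) mul2n -addnn.
congr (_ + _).
  apply: eq_cnt => p q sp sq; have [|_] := boolP (pre _ q); last by rewrite !andbF.
  rewrite /col /row; case: q sq => [|[] [|[] [|[] q]]] //= _ _.
  by rewrite !andbF !andbT.
rewrite /notch -[RHS]cnt_flip; apply: eq_cnt => p q sp sq; rewrite admissible_flip.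
have [ad|//] := boolP (admissible e p q).
have -> : pre [:: N; E; N] (flip p) = pre [:: E; N; E] p.
  by case: (p) => [|[] [|[] [|[] p']]]; rewrite /pre /= ?take0.
(* The start [ENE] rules out both removals and, by strictness, the start [NEN] of [q]; without it,
   [minimal_start] leaves only [NEN]. *)
have [pp|pp] := boolP (pre _ p).
  case/andP: ad => s _; rewrite /col /row.
  case: p sp pp s => [|[] [|[] [|[] p]]] //= sp _.
  by case: q sq => [|[] [|[] [|[] q]]] //=; rewrite -?sp.
apply/negP => /andP[/and3P[_ nc nr] nq].
have := minimal_start ad _ nc nr; rewrite sp (negbTE pp) (negbTE nq).
by move/(_ n2).
Qed.

Lemma cnt_admissible_rec e n :
  cnt n.+1 (admissible e) =
  cnt n (admissible e) + cnt n.+1 (fun p q => admissible e p q && ~~ col p q).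
Proof. by rewrite (cnt_split _ col) cnt_col. Qed.

(** Pairs without a removable column either lose a row or start with one of the two protruding
    cells. *)
Lemma cnt_nocol_rec e n : 1 < n ->
  cnt n.+1 (fun p q => admissible e p q && ~~ col p q) =
  cnt n (fun p q => admissible e p q && ~~ col p q) + 2 * notch e n.+1.
Proof.
move=> n1; rewrite -cnt_nocol_norow // -(cnt_nocol_row e n) (cnt_split _ row).
by congr (_ + _); apply: eq_cnt => p q _ _; rewrite -andbA // [~~ _ && _]andbC.
Qed.

(** * Small lengths, and cutting off a single protruding cell *)

Lemma cnt2 e (X : seq bool -> seq bool -> bool) : X [:: E; N] [:: N; E] ->
  cnt 2 (fun p q => admissible e p q && X p q) = 1.
Proof.
move=> x; rewrite -[RHS](cards1 ([tuple E; N], [tuple N; E])).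
apply: eq_card => -[[[|[] [|[] [|? ?]]] // sp] [[|[] [|[] [|? ?]]] // sq]].
all: by rewrite !inE /= ?andbF //= ?x.
Qed.

Lemma notch3 e : notch e 3 = 0.
Proof.
apply/eqP; rewrite cards_eq0; apply/eqP/setP => -[[p sp] [q sq]]; rewrite !inE /=.
by case: q sq => [|[] [|[] [|[] [|? ?]]]] //; case: p sp => [|[] [|[] [|[] [|? ?]]]].
Qed.

(** With [q] starting [NE], the first column is a single cell; deleting the first [E] of both words
    cuts it off. *)
Lemma strict_cell p q : 1 < size p ->
  strict (E :: p) [:: N, E & q] = strict p (N :: q).
Proof. by case: p => [|[] [|b p]] //=; rewrite ?andbF //; case: q. Qed.

Lemma en_corners_cell_E q :
  en_corners [:: N, E, E & q] = map (move_by 1 0) (en_corners [:: N, E & q]).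
Proof. by rewrite !en_cornersN en_cornersEE -!map_comp. Qed.

Lemma en_corners_cell_N q :
  en_corners [:: N, E, N & q] =
  (1, 1) :: map (move_by 1 0) (en_corners [:: N, N & q]).
Proof. by rewrite en_cornersN en_cornersEN /= ![in RHS]en_cornersN en_cornersN -!map_comp. Qed.

Lemma ne_corners_gt0 p b : b \in ne_corners p -> 0 < b.2.
Proof. by case/mem_ne_corners => k [/vertexSr e _ ->]; rewrite e addn1. Qed.

(** Cutting the cell off loses at most the corner (1, 1) of the upper path. In the strict sense it
    is mixed with nothing, because every corner of the lower path has height at least 1. *)
Lemma cell_admissible p q : 1 < size p -> size p = (size q).+1 ->
  admissible 0 (E :: p) [:: N, E & q] = admissible 0 p (N :: q).
Proof.
move=> p1 spq; rewrite /admissible strict_cell //; congr (_ && _).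
rewrite /unmixed ne_cornersE; case: q spq => [|[] q] spq; first by rewrite spq in p1.
  rewrite en_corners_cell_N allrel_consl allrel_mixed_shift andb_idl // => _.
  by apply/allP => _ /mapP[[b1 b2] /ne_corners_gt0 /= b0 ->];
    rewrite /mixed /move_by /=; lia.
by rewrite en_corners_cell_E allrel_mixed_shift.
Qed.

Lemma doubled_N_ne_corners p b : doubled N p -> b \in ne_corners p -> 1 < b.2.
Proof.
elim: p b => [|[] p IHp] b //=; last first.
  by move=> /IHp h; rewrite ne_cornersE => /mapP[c /h c1 ->].
case: p {IHp} => [|[] p] //= _.
rewrite /ne_corners en_cornersEE -map_comp => /mapP[c cp ->] /=.
have : swap c \in ne_corners (N :: p) by apply/mapP; exists c.
by move=> /ne_corners_gt0 /=; lia.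
Qed.

(** In the weak sense the corner (1, 1) forbids exactly the corners of the lower path at height 1.
    Such a corner is absent precisely when the first [N] of [p] is doubled; the upper word [NN...]
    is doubled anyway, so the condition is [row]. *)
Lemma notch_admissible p q : 2 < size p ->
  admissible 1 (E :: p) [:: N, E, N & q] =
  admissible 1 p [:: N, N & q] && row p [:: N, N & q].
Proof.
move=> p2; rewrite /admissible strict_cell; last exact: ltn_trans p2.
rewrite -andbA; have [s /=|//] := boolP (strict p _).
rewrite /unmixed ne_cornersE en_corners_cell_N allrel_consl allrel_mixed_shift andbC.
congr (_ && _); rewrite /row /= eqxx andbT.
apply/allP/idP => [h|dp _ /mapP[[b1 b2] /(doubled_N_ne_corners dp) /= b0 ->]].
  apply/negPn/negP => dp; have [k kc _] := corner_of_not_doubled_N s p2 dp (eqxx _).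
  by have := h (move_by 1 0 (k.+1, 1)) (map_f _ kc); rewrite /mixed /move_by /=; lia.
by rewrite /mixed /move_by /=; lia.
Qed.

Lemma cnt_cell n (X Y : seq bool -> seq bool -> bool) :
  (forall p q, X p q -> head N p = E /\ pre [:: N; E] q) ->
  (forall p q, Y p q -> head E q = N) ->
  (forall p q, size p = n -> size p = (size q).+1 ->
     X (E :: p) [:: N, E & q] = Y p (N :: q)) ->
  cnt n.+1 X = cnt n Y.
Proof.
move=> hX hY XY; apply: (@cnt_bij _ _ _ _ behead (rem E) (cons E)
    (fun q => [:: N, E & behead q])) => p q.
  case: p => [|b p] // [sp] sq x; have [hp hq] := hX _ _ x.
  case: q sq hq x => [|[] [|[] q]] // [sq] _; rewrite /= in hp; rewrite hp.
  by rewrite XY ?sq // => y; rewrite /= -sq.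
move=> sp sq y; have := hY _ _ y; case: q sq y => [|[] q] // sq y _.
by rewrite XY ?sq //= sp -sq.
Qed.

(** Cutting the cell off a notched pair leaves an upper path starting [NN]. The remaining pairs of
    length [n + 1] have an upper path starting [NE] and lose one more cell, giving all pairs of
    length [n]. *)
Lemma notch0_rec n : 1 < n ->
  notch 0 n.+2 + cnt n (admissible 0) = cnt n.+1 (admissible 0).
Proof.
move=> n1; rewrite [RHS](cnt_split _ (fun _ q => pre [:: N; N] q)).
have hd p q : admissible 0 p q -> head N p = E /\ head E q = N.
  by case/andP=> /strict_heads.
congr (_ + _).
  apply: cnt_cell => p q; first by case/andP=> /hd[-> _]; case: q =>
    [|[] [|[] [|[] q]]].
    by case/andP=> /hd[].
  case: q => [|[] q] sp spq; rewrite ?andbF //.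
  by rewrite cell_admissible // sp ltnS ltnW.
symmetry; apply: cnt_cell => p q; last first.
- by move=> sp spq; rewrite cell_admissible ?andbT // sp.
- by move/hd => [].
case/andP=> ad nn; have [-> hq] := hd _ _ ad; split=> //.
case/andP: ad => s _; case: q s hq nn => [|[] [|[] q]] //.
- by case: p => [|[] [|? ?]].
- by rewrite /pre /= take0.
- by rewrite /pre /= take0.
Qed.

(** Here cutting the cell off leaves exactly the pairs with a removable first row, and that row is
    removed next. *)
Lemma notch1_rec n : 1 < n -> notch 1 n.+2 = cnt n (admissible 1).
Proof.
move=> n1; transitivity
  (cnt n.+1 (fun p q => [&& admissible 1 p q, row p q & true])); last first.
  by rewrite cnt_row //; apply: eq_cnt => p q _ _; rewrite andbT.
have hd p q : admissible 1 p q -> head N p = E /\ head E q = N.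
  by case/andP=> /strict_heads.
apply: cnt_cell => p q; first by case/andP=> /hd[-> _]; case: q => [|[] [|[] [|[] q]]].
  by case/andP=> /hd[].
case: q => [|[] q] sp spq; rewrite andbT.
- by move: n1; rewrite -ltnS -sp spq.
- by rewrite /pre /= take0 eqxx andbT notch_admissible // sp.
- by rewrite /row /pre /= !andbF.
Qed.

(** * Solving the two recurrences *)

Lemma cnt_admissible0 n : (cnt n.+2 (admissible 0)).*2 = 3 ^ n + 1.
Proof.
pose a k := cnt k (admissible 0).
pose r k := cnt k (fun p q => admissible 0 p q && ~~ col p q).
have a2 : a 2 = 1.
  rewrite /a -[RHS](@cnt2 0 (fun _ _ => true)) //.
  by apply: eq_cnt => p q _ _; rewrite andbT.
(* The increments of [r] are twice those of [a] one length earlier, so the recurrence telescopes; it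
   turns a(n+3) = a(n+2) + r(n+3) into a(n+3) = 3 a(n+2) - 1. *)
have ar k : r k.+3 + 1 = (a k.+2).*2.
  elim: k => [|k IHk]; first by rewrite a2 /r cnt_nocol_rec // notch3 cnt2.
  rewrite /r cnt_nocol_rec // -/(r k.+3).
  have := @notch0_rec k.+2 isT; rewrite -/(a k.+2) -/(a k.+3); lia.
rewrite -/(a n.+2); elim: n => [|n IHn]; first by rewrite a2.
by rewrite /a cnt_admissible_rec -/(a _) -/(r _) expnS; have := ar n; lia.
Qed.

Lemma cnt_admissible1 n : cnt n.+2 (admissible 1) = pell n.+1.
Proof.
pose a k := cnt k (admissible 1).
pose r k := cnt k (fun p q => admissible 1 p q && ~~ col p q).
have a2 : a 2 = 1.
  rewrite /a -[RHS](@cnt2 1 (fun _ _ => true)) //.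
  by apply: eq_cnt => p q _ _; rewrite andbT.
have a3 : a 3 = 2 by rewrite /a cnt_admissible_rec -/(a 2) a2 cnt_nocol_rec // notch3 cnt2.
suff [] : a n.+2 = pell n.+1 /\ a n.+3 = pell n.+2 by [].
elim: n => [|n [h1 h2]]; first by rewrite a2 a3.
split=> //; have -> : pell n.+3 = 2 * pell n.+2 + pell n.+1 by [].
(* This gives a(n+4) = a(n+3) + r(n+3) + 2 a(n+2), where r(n+3) = a(n+3) - a(n+2). *)
rewrite -h1 -h2 /a cnt_admissible_rec cnt_nocol_rec // notch1_rec // -!/(a _).
by have : a n.+3 = a n.+2 + r n.+3 := cnt_admissible_rec _ _; rewrite /r; lia.
Qed.

(** * Diagrams *)

Lemma vertex2_eq p q k : size p = size q ->
  (vertex p k).2 = (vertex q k).2 -> vertex p k = vertex q k.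
Proof.
move=> s e; have := vertexD p k; have := vertexD q k; rewrite s -e.
by case: (vertex p k) (vertex q k) e => ? ? [? ?] /= -> <- /addIn ->.
Qed.

Lemma strictly_below_strict n (P Q : lpath n) :
  1 < n -> strictly_below P Q = strict P Q.
Proof.
move=> n1; apply/andP/strictP; rewrite ?size_tuple //.
- move=> [/eqP e /forallP h]; split; first by rewrite e.
  by move=> k /andP[k0 kn]; have /implyP := h (Ordinal kn); apply.
- move=> [e h]; split; first by apply/eqP/vertex2_eq; rewrite ?size_tuple.
  by apply/forallP => k; apply/implyP => k0; apply: h; rewrite k0 ltn_ord.
Qed.

Lemma meet_only_at_ends_strict n (P Q : lpath n) :
  1 < n -> meet_only_at_ends P Q = strict P Q.
Proof.
move=> n1; rewrite -strictly_below_strict // /strictly_below.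
rewrite /meet_only_at_ends; congr (_ && _); apply/andP/forallP.
  move=> [/forallP h1 /forallP h2] k; apply/implyP => k0.
  rewrite ltn_neqAle h1 andbT; have := h2 k; rewrite k0 /=; apply: contraNneq => e.
  by apply/eqP/vertex2_eq; rewrite ?size_tuple.
move=> h; split; apply/forallP => k; last first.
  apply/implyP => k0; have := h k; rewrite k0 /=; apply: contraTneq => ->.
  by rewrite ltnn.
case: (posnP k) => [->|k0]; first by rewrite !vertex0.
by have := h k; rewrite k0 => /ltnW.
Qed.

Lemma card_lt_ord n m : m <= n -> #|[set k : 'I_n | k < m]| = m.
Proof.
move=> le_mn; have wI : injective (widen_ord le_mn).
  by move=> i j /(congr1 val) /= e; apply: val_inj.
rewrite -[RHS]card_ord -cardsT -(card_imset _ wI).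
apply: eq_card => k; rewrite inE; apply/idP/imsetP => [km|[j _ ->]];
  last exact: (valP j).
by exists (Ordinal km) => //; apply: val_inj.
Qed.

Lemma non_mixed_unmixed n (P Q : lpath n) :
  `[< non_mixed P Q >] = unmixed 0 P Q.
Proof.
(* The flats enter only through these cardinalities, which turn their corners into the vertices
   listed by [en_corners] and [ne_corners]. *)
have cF i : i < n -> #|finset (fun k : 'I_n => k <= i)| = i.+1.
  by move=> lin; rewrite -[RHS](card_lt_ord lin); apply: eq_card => k; rewrite !inE.
have cG j : j < n -> #|~: finset (fun k : 'I_n => j < k)| = j.+1.
  by move=> ljn; rewrite -[RHS](card_lt_ord ljn); apply: eq_card => k;
    rewrite !inE ltnNge negbK.
have mixE F G : mixed_pair P Q F G = mixed 0 (vertex Q #|F|) (vertex P #|~: G|).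
  by rewrite /mixed_pair /mixed !addn0.
apply/asboolP/allrelP =>
  [h _ _ /mem_en_corners[i [i1 i2 ->]] /mem_ne_corners[j [j1 j2 ->]]|h F G].
  have := onth_size i1; have := onth_size j1; rewrite !size_tuple => jn ins.
  rewrite -(cF _ ins) -(cG _ jn) -mixE; apply: h; [by exists i | by exists j].
move=> [i [i1 i2 ->]] [j [j1 j2 ->]].
have := onth_size i1; have := onth_size j1; rewrite !size_tuple => jn ins.
rewrite mixE cF // cG //.
by apply: h; [apply/mem_en_corners; exists i | apply/mem_ne_corners; exists j].
Qed.

Lemma non_mixed_pairsE n : 1 < n ->
  [set PQ : lpath n * lpath n | strictly_below PQ.1 PQ.2 && `[< non_mixed PQ.1 PQ.2 >]] =
  [set PQ : lpath n * lpath n | admissible 0 PQ.1 PQ.2].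
Proof.
by move=> n1; apply/setP => PQ; rewrite !inE strictly_below_strict // non_mixed_unmixed.
Qed.

(** A discrete intermediate value property: the abscissa starts at 0 and grows by at most one per
    step. *)
Lemma step_in_column w s i : i < (vertex w s).1 ->
  exists2 k, k < s & onth w k = Some E /\ (vertex w k).1 = i.
Proof.
elim: s => [|s IHs]; first by rewrite vertex0.
have [sw|ws] := ltnP s (size w); last first.
  rewrite (vertex_oversize (leqW ws)) -(vertex_oversize ws).
  by move=> /IHs[k ks h]; exists k => //; apply: ltnW.
have [b sb] := onth_lt sw; rewrite (vertexSr sb) /=.
have [/IHs[k ks h]|le_si] := ltnP i (vertex w s).1; first by exists k => //;
  apply: ltnW.
by case: b sb => sb; rewrite ?addn0 ?addn1 => ?; [lia | exists s => //; split=> //;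
  lia].
Qed.

(** The falling diagonal of the cell lies on the line x + y = i + j + 1, so only the vertex of the
    path on that line matters. *)
Lemma above_pathP w i j : above_path w (i, j) <-> i < (vertex w (i + j).+1).1.
Proof.
split=> [[k [ke /= kx ky]]|/step_in_column[k kl [ke kx]]].
  have kw := onth_size ke; have kD := vertexD w k.
  rewrite -kx -addn1; have ->
    : (vertex w k).1 + 1 = (vertex w k.+1).1 by rewrite (vertexSr ke).
  by apply: vertex1_mono; lia.
exists k; split=> //=; have kw := onth_size ke; have := vertexD w k; lia.
Qed.

Lemma below_pathP w i j : below_path w (i, j) <->
  (vertex w (i + j).+1).1 <= i < (vertex w (size w)).1.
Proof.
split=> [[k [ke /= kx ky]]|/andP[h1 /step_in_column[k kl [ke kx]]]].
  have kw := onth_size ke; have kD := vertexD w k.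
  apply/andP; split; first by rewrite -kx; apply: vertex1_mono; lia.
  rewrite -kx -addn1; have ->
    : (vertex w k).1 + 1 = (vertex w k.+1).1 by rewrite (vertexSr ke).
  exact: vertex1_mono.
exists k; split=> //=; have kD := vertexD w k.
have [kij|] := ltnP k (i + j).+1; last by lia.
have := @vertex1_mono w k.+1 (i + j).+1 kij; rewrite (vertexSr ke) /=; lia.
Qed.

Lemma strict_end p q : strict p q -> vertex p (size p) = vertex q (size p).
Proof.
move=> s; have spq := strict_size s; apply: vertex2_eq => //.
by rewrite {2}spq !vertex_size (strict_N s).
Qed.

Lemma in_squares n (P Q : lpath n) (c : 'I_n * 'I_n) : strict P Q ->
  (c \in squares (P, Q)) =
  ((vertex Q (c.1 + c.2).+1).1 <= c.1 < (vertex P (c.1 + c.2).+1).1).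
Proof.
case: c => i j s; rewrite inE; apply/asboolP/andP => /=.
  by case=> /above_pathP h1 /below_pathP/andP[h2 h3].
move=> [h1 h2]; split; first exact/above_pathP.
apply/below_pathP; rewrite h1 size_tuple /=; apply: leq_trans h2 _.
have := strict_end s; rewrite size_tuple => <-.
have [l|g] := leqP (i + j).+1 n; first exact: vertex1_mono.
by rewrite (vertex_oversize (w := P)) size_tuple // ltnW.
Qed.

Lemma strict_gap p q k : strict p q -> 0 < k < size p ->
  (vertex q k).1 < (vertex p k).1 /\ (vertex p k).2 < (vertex q k).2.
Proof.
move=> s k0; have spq := strict_size s.
have [|_ h] := strictP spq _ s; first by lia.
by have := h _ k0; have := vertexD p k; have := vertexD q k; rewrite -spq; lia.
Qed.

Lemma eq_vertex1 u v : size u = size v ->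
  (forall k, k <= size u -> (vertex u k).1 = (vertex v k).1) -> u = v.
Proof.
elim: u v => [|b u IHu] [|c v] //= [suv] h.
have := h 1 isT; rewrite !vertexS !vertex0 /= !addn0 => ebc.
have -> : b = c by case: b c ebc {h} => [] [].
congr cons; apply: IHu => // k ku.
by have := h k.+1 ku; rewrite !vertexS /=; lia.
Qed.

(** The cells on one antidiagonal form a nonempty interval of abscissas with ends given by the two
    paths; inclusion of intervals compares the ends. *)
Lemma squares_sub n (P Q P' Q' : lpath n) k : strict P Q -> strict P' Q' ->
  squares (P, Q) \subset squares (P', Q') -> 0 < k < n ->
  (vertex Q' k).1 <= (vertex Q k).1 /\ (vertex P k).1 <= (vertex P' k).1.
Proof.
move=> s s' /fintype.subsetP sub k0; have := strict_gap (k := k) s;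
  rewrite size_tuple => /(_ k0)[g _].
have Dp := vertexD P k; have Dq := vertexD Q k; rewrite !size_tuple in Dp Dq.
have cell i : (vertex Q k).1 <= i < (vertex P k).1 ->
  (vertex Q' k).1 <= i < (vertex P' k).1.
  move=> h; have ni : i < n by lia.
  have nj : k.-1 - i < n by lia.
  have := sub (Ordinal ni, Ordinal nj); rewrite !in_squares //=.
  have -> : (i + (k.-1 - i)).+1 = k by lia.
  exact.
have := cell (vertex Q k).1; have := cell (vertex P k).1.-1; lia.
Qed.

Lemma strict_last p q : strict p q -> 1 < size p ->
  (vertex p (size p)).1 = (vertex p (size p).-1).1 /\
  (vertex q (size p)).1 = (vertex q (size p).-1).1.+1.
Proof.
move=> s p1; have spq := strict_size s.
have [|g _] := strict_gap (k := (size p).-1) s; first by lia.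
have ep := strict_end s.
have [b hb] : exists b, onth p (size p).-1 = Some b by apply: onth_lt; lia.
have [c hc] : exists b, onth q (size p).-1 = Some b by apply: onth_lt; lia.
have := vertexSr hb; have := vertexSr hc; rewrite prednK; last by lia.
by move: ep g => <- g -> /(congr1 fst) /=; case: b c {hb hc} => [] []; lia.
Qed.

Lemma squares_inj n : 1 < n ->
  {in [set PQ : lpath n * lpath n | strict PQ.1 PQ.2] &, injective (@squares n)}.
Proof.
move=> n1 [P Q] [P' Q']; rewrite !inE /= => s s' e.
have sub : squares (P, Q) \subset squares (P', Q') by rewrite e.
have sub' : squares (P', Q') \subset squares (P, Q) by rewrite e.
have h k : k < n ->
  (vertex P k).1 = (vertex P' k).1 /\ (vertex Q k).1 = (vertex Q' k).1.
  case: (posnP k) => [->|k0 kn]; first by rewrite !vertex0.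
  have k0n : 0 < k < n by rewrite k0.
  have [h1 h2] := squares_sub s s' sub k0n.
  have [h3 h4] := squares_sub s' s sub' k0n.
  by split; apply/eqP; rewrite eqn_leq ?h1 ?h2 ?h3 ?h4.
have [|l1 l2] := strict_last s; first by rewrite size_tuple.
rewrite size_tuple in l1 l2.
have [|l1' l2'] := strict_last s'; first by rewrite size_tuple.
rewrite size_tuple in l1' l2'.
have [|h1 h2] := h n.-1; first by lia.
congr pair; apply: val_inj; apply: eq_vertex1; rewrite !size_tuple // => k.
  by rewrite leq_eqVlt => /predU1P[->|/h[]//]; rewrite l1 l1' h1.
by rewrite leq_eqVlt => /predU1P[->|/h[]//]; rewrite l2 l2' h2.
Qed.

Lemma card_diagrams n (X : seq bool -> seq bool -> bool) :
  1 < n -> (forall p q, X p q -> strict p q) ->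
  #|@squares n @: [set PQ : lpath n * lpath n | X PQ.1 PQ.2]| = cnt n X.
Proof.
move=> n1 hX; apply: card_in_imset => PQ PQ'; rewrite !inE => /hX s /hX s'.
by apply: squares_inj; rewrite // inE.
Qed.

(** * Thick diagrams *)

(* No two vertices of the paths, other than the end vertices of the diagram,
   span a horizontal or vertical unit segment. *)
Definition wide (p q : seq bool) : Prop :=
  forall k, 0 < k -> k.+1 < size p ->
    (vertex p k.+1).2 < (vertex q k).2 /\ (vertex p k).2.+1 < (vertex q k.+1).2.

Lemma wide_flip p q : size p = size q -> wide p q -> wide (flip q) (flip p).
Proof.
move=> s w k k0; rewrite size_flip -s => k1; have [h1 h2] := w k k0 k1.
rewrite !vertex_flip /=.
have := vertexD p k; have := vertexD q k; have := vertexD p k.+1;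
  have := vertexD q k.+1.
by rewrite -s; lia.
Qed.

(** * Stripping the first and last steps of both paths *)

Section Peel.
Variables p q : seq bool.
Hypotheses (spq : size p = size q) (p1 : 1 < size p).

Let P := E :: rcons p N.
Let Q := N :: rcons q E.

Lemma vertex_rcons w b k : k <= size w -> vertex (rcons w b) k = vertex w k.
Proof.
elim: w k => [|c w IHw] [|k] //=; rewrite ?vertex0 // ltnS => kw.
by rewrite !vertexS IHw.
Qed.

Let vP k : k <= size p -> vertex P k.+1 = ((vertex p k).1.+1, (vertex p k).2).
Proof. by move=> kp; rewrite vertexS vertex_rcons. Qed.

Let vQ k : k <= size p -> vertex Q k.+1 = ((vertex q k).1, (vertex q k).2.+1).
Proof. by move=> kp; rewrite vertexS vertex_rcons -?spq. Qed.

Let sP : size P = (size p).+2. Proof. by rewrite /= size_rcons. Qed.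
Let sQ : size Q = (size p).+2. Proof. by rewrite /= size_rcons spq. Qed.

Let eP : (vertex P (size p).+2).2 = (vertex p (size p)).2.+1.
Proof. by rewrite -sP !vertex_size /P /= -cats1 count_cat /= add0n addn1. Qed.

Let eQ : (vertex Q (size p).+2).2 = (vertex q (size p)).2.+1.
Proof. by rewrite -sQ spq !vertex_size /Q /= -cats1 count_cat /= !addn0 add1n. Qed.

(** Inner vertices of [P] are those of [p] moved right by one, inner vertices of [Q] those of [q]
    moved up by one; this widens every gap by one unit in each direction. *)
Lemma strict_wide_peel : strict p q -> strict P Q /\ wide P Q.
Proof.
move=> s; have [e h] := strictP spq p1 s.
have le k : k <= size p -> (vertex p k).2 <= (vertex q k).2.
  case: (posnP k) => [->|k0]; first by rewrite !vertex0.
  rewrite leq_eqVlt => /predU1P[->|kp]; first by rewrite e spq.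
  by apply/ltnW/h; rewrite k0.
have [l1 l2] := strict_last s p1.
split.
  apply/strictP; rewrite ?sP ?sQ //; split; first by rewrite eP eQ e spq.
  move=> [|k] // /andP[_ kp]; have {}kp : k <= size p by [].
  by rewrite vP ?vQ //; apply: le.
move=> [|k] // _; rewrite sP => kp; have {}kp : k < size p by [].
rewrite (vP (ltnW kp)) (vQ (ltnW kp)) (vP kp) (vQ kp) [_.2]/= [X in X /\ _]/=.
have Dp := vertexD p k; have Dp1 := vertexD p k.+1.
have Dq := vertexD q k; have Dq1 := vertexD q k.+1.
have [b hb] := onth_lt kp; have vb := vertexSr hb.
have [c hc] : exists b, onth q k = Some b by apply: onth_lt; rewrite -spq.
have vc := vertexSr hc.
rewrite vb vc /=; have lek := le _ (ltnW kp).
have [k0|k0] := posnP k.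
  move: hb hc; rewrite k0 !vertex0 /=.
  by case: (p) (q) s => [|[] p'] [|[] q'] //= _ [<-] [<-].
have hk := h k; rewrite k0 kp /= in hk; have {}hk := hk isT.
by case: b c hb hc vb vc => [] [] _ _ _ _ /=; lia.
Qed.

(** If the inner paths touched at an inner vertex, width would force the steps [NE] of [p] and [EN]
    of [q] around it. The vertex would be a corner of both paths, hence weakly mixed with itself. *)
Lemma peel_strict : unmixed 1 p q -> strict P Q -> wide P Q -> strict p q.
Proof.
move=> u s w; have [||e _] := strictP _ _ s; rewrite ?sP ?sQ //.
rewrite ?sP ?sQ eP eQ in e; case: e => e.
apply/strictP => //; split; first by rewrite e spq.
move=> k /andP[k0 kp]; rewrite ltnNge; apply/negP => le.
have [||w1 w2] := w k; rewrite ?sP //; first by rewrite !ltnS ltnW.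
have [||w3 w4] := w k.+1; rewrite ?sP ?ltnS //.
case: k k0 kp le w1 w2 w3 w4 => // k _ kp le.
have k0 := ltnW (ltnW kp); have k1 := ltnW kp.
rewrite (vP k0) (vQ k0) (vP k1) (vQ k1) (vP kp) (vQ kp) => w1 w2 w3 w4.
have kq := kp; rewrite spq in kq.
have [b hb] := onth_lt kp; have vb := vertexSr hb.
have [c hc] := onth_lt kq; have vc := vertexSr hc.
have [b' hb'] := onth_lt (ltnW kp); have vb' := vertexSr hb'.
have [c' hc'] := onth_lt (ltnW kq); have vc' := vertexSr hc'.
move: w1 w2 w3 w4; rewrite vb vc /= => w1 w2 w3 w4.
have := vertexD p k.+1; have := vertexD q k.+1; rewrite -spq => D1 D2.
have eb : b' = N by case: b' vb' {hb'} => // vb'; rewrite vb' vc' /= in le w1 w2; lia.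
have ec : c' = E by case: c' vc' {hc'} => // vc'; rewrite vb' vc' /= in le w1 w2; lia.
have eb1 : b = E by case: b vb w3 {hb} => //=; lia.
have ec1 : c = N by case: c vc w4 {hc} => //=; lia.
subst b c b' c'.
have cq : vertex q k.+1 \in en_corners q by apply/mem_en_corners; exists k.
have cp : vertex p k.+1 \in ne_corners p by apply/mem_ne_corners; exists k.
move/allrelP: u => /(_ _ _ cq cp) /negP; apply; rewrite /mixed.
by apply/andP; lia.
Qed.

Lemma en_corners_rcons_E w : en_corners (rcons w E) = en_corners w.
Proof.
rewrite /en_corners; elim: w 0 {2 4}0 => [|[] w IHw] //= x y.
by rewrite IHw; case: w {IHw}.
Qed.

(** The different shifts of the two sets of corners, up and right, relax both strict inequalities to
    weak ones. *)
Lemma unmixed_peel : unmixed 0 P Q = unmixed 1 p q.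
Proof.
rewrite /unmixed en_cornersN en_corners_rcons_E ne_cornersE /ne_corners.
rewrite (_ : flip (rcons p N) = rcons (flip p) E); last exact: map_rcons.
rewrite en_corners_rcons_E allrel_mapl allrel_mapr.
by apply: eq_allrel => a b; rewrite /mixed /move_by /= !addn0 add0n !add1n !addn1.
Qed.

Lemma peel_admissible :
  [/\ strict P Q, unmixed 0 P Q & wide P Q] <-> admissible 1 p q.
Proof.
rewrite unmixed_peel; split=> [[s u w]|/andP[s u]].
  by rewrite /admissible u peel_strict.
by have [] := strict_wide_peel s.
Qed.

End Peel.

Lemma vertex_rcons_last w b : (vertex (rcons w b) (size w).+1).1 =
  (vertex (rcons w b) (size w)).1 + ~~ b.
Proof.
rewrite (vertex_rcons _ (leqnn _)) -(size_rcons w b) !vertex_size -cats1 count_cat /= addn0.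
by case: b.
Qed.

Lemma strict_ends p q : strict p q -> 1 < size p ->
  exists p' q', p = E :: rcons p' N /\ q = N :: rcons q' E.
Proof.
move=> s p1; have spq := strict_size s; have [l1 l2] := strict_last s p1.
case/lastP: p p1 s spq l1 l2 => [|p b] // p1 s spq.
case/lastP: q s spq => [|q c] s; first by rewrite size_rcons.
rewrite !size_rcons => -[spq]; rewrite [_.+1.-1]/= {3 4}spq !vertex_rcons_last.
case: b s p1 => s p1; last by lia.
case: c s => s; [lia | move=> _ _].
rewrite size_rcons in p1.
case: p p1 s spq => [|[] p] // _; case: q => [|[] q] // s _.
by exists p, q.
Qed.

Lemma cnt_wide n : 1 < n ->
  cnt n.+2 (fun p q => `[< [/\ strict p q, unmixed 0 p q & wide p q] >]) =
  cnt n (admissible 1).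
Proof.
move=> n1; pose f (w : seq bool) := behead (take (size w).-1 w).
have fK b c w : f (b :: rcons w c) = w.
  by rewrite /f /= size_rcons /= -cats1 take_size_cat.
apply: (@cnt_bij _ _ _ _ f f (fun w => E :: rcons w N) (fun w => N :: rcons w E)) =>
  p q sp sq.
  move=> /asboolP h; have [s _ _] := h.
  have [|p' [q' [ep eq]]] := strict_ends s; first by rewrite sp.
  move: sp sq; rewrite ep eq !fK /= !size_rcons => -[sp] [sq]; split=> //.
  by apply/(peel_admissible (p := p')); rewrite ?sp ?sq // -ep -eq.
move=> ad; rewrite !fK /= !size_rcons sp sq; split=> //.
by apply/asboolP/peel_admissible; rewrite ?sp ?sq.
Qed.

Import Order.TTheory GRing.Theory Num.Theory.
Import numFieldNormedType.Exports.

(** For vertices of equal height the difference of indices is the horizontal distance. If [l] is too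
    large for [wide] to apply, [q] has already reached the full height, because the last step of [p]
    is [N]. *)
Lemma wide_far p q k l : strict p q -> wide p q ->
  k <= size p -> (vertex p k).2 = (vertex q l).2 ->
  0 < (vertex p k).2 < (vertex p (size p)).2 -> l.+2 <= k.
Proof.
move=> s w kp e /andP[y0 yr]; rewrite ltnNge; apply/negP => kl.
have l0 : 0 < l by case: l e {kl} => // e; rewrite e vertex0 in y0.
have hkl := vertex2_mono p kl.
have [l1|l1] := ltnP l.+1 (size p); first by have [] := w l l0 l1; lia.
have p1 : 1 < size p.
  by case: (p) yr y0 => [|b [|c p']] //=; rewrite ?vertexS ?vertex0 /=; lia.
have [|_ g] := strict_gap (k := (size p).-1) s; first by lia.
have hl : (vertex q (size p).-1).2 <= (vertex q l).2 by apply: vertex2_mono; lia.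
have [e1 _] := strict_last s p1.
by have := vertexD p (size p); have := vertexD p (size p).-1; lia.
Qed.

Lemma wide_far_step p q k l : strict p q -> wide p q -> 3 < size p ->
  onth p k = Some N -> onth q l = Some N ->
  (vertex p k).2 = (vertex q l).2 -> l.+2 <= k.
Proof.
move=> s w p3 pk ql e; have kp := onth_size pk.
have vk := vertexSr pk; have vl := vertexSr ql.
have r1 := vertex2_mono p kp.
have [y0|y0] := posnP (vertex p k).2; last first.
  by apply: (wide_far s w (ltnW kp) e); rewrite vk /= in r1; lia.
(* At height 0 the upper ends of the two steps are compared instead; width makes the diagram at
   least two rows high, so height 1 is allowed. *)
rewrite -ltnS; apply: (wide_far s w kp); first by rewrite vk vl /= e.
have [|_ r2] := w 1 isT; first by lia.
have h2 := vertex2_mono q (_ : 2 <= size q); have h3 := strict_end s.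
have spq := strict_size s; rewrite h3 [in size p]spq vk y0 /=.
by have := h2; rewrite -spq => /(_ (ltnW (ltnW p3))); lia.
Qed.

(** * Segments and interior points in the real plane *)

Section Geometry.
Local Open Scope ring_scope.
Variable R : realType.

Lemma on_path_flip w (z : R * R) :
  on_path w z -> on_path (flip w) (z.2, z.1).
Proof.
move=> [k [t t01 h]]; exists k, t => //; rewrite vertex_flip.
by case: h => -[h ->]; [right | left]; split=> //; apply/onth_flip.
Qed.

(** Meant for bounding abscissas from below: a point of integer height is compared with a vertex to
    its left, any other point is inside a north step. [on_path_left] is the counterpart for the
    upper path. *)
Lemma on_path_right w (z : R * R) : on_path w z ->
  (exists k, [/\ (k <= size w)%N,
    z.2 = (vertex w k).2%:R & (vertex w k).1%:R <= z.1]) \/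
  (exists k t, [/\ onth w k = Some N, 0 < t < 1,
    z.2 = (vertex w k).2%:R + t & z.1 = (vertex w k).1%:R]).
Proof.
move=> [k [t /andP[t0 t1] [[h ->]|[h ->]]]] /=; have kw := onth_size h.
  by left; exists k; rewrite ltnW // lerDl.
move: t0 t1; rewrite le_eqVlt => /predU1P[<- _|t0].
  by left; exists k; rewrite ltnW // addr0.
rewrite le_eqVlt => /predU1P[->|t1]; last by right; exists k, t; rewrite t0.
by left; exists k.+1; rewrite (vertexSr h) /= addn0 natrD.
Qed.

Lemma on_path_left w (z : R * R) : on_path w z ->
  (exists k, [/\ (k <= size w)%N,
    z.2 = (vertex w k).2%:R & z.1 <= (vertex w k).1%:R]) \/
  (exists k t, [/\ onth w k = Some N, 0 < t < 1,
    z.2 = (vertex w k).2%:R + t & z.1 = (vertex w k).1%:R]).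
Proof.
move=> [k [t /andP[t0 t1] [[h ->]|[h ->]]]] /=; have kw := onth_size h.
  by left; exists k.+1; rewrite (vertexSr h) /= addn0 natrD lerD2l.
move: t0 t1; rewrite le_eqVlt => /predU1P[<- _|t0].
  by left; exists k; rewrite ltnW // addr0.
rewrite le_eqVlt => /predU1P[->|t1]; last by right; exists k, t; rewrite t0.
by left; exists k.+1; rewrite (vertexSr h) /= addn0 natrD.
Qed.

Lemma natr_between (a b : nat) (t : R) : 0 < t < 1 -> a%:R <> b%:R + t.
Proof.
move=> /andP[t0 t1] e; have : (b < a)%N by rewrite -(ltr_nat R) e ltrDl.
by apply/negP; rewrite -leqNgt -ltnS -(ltr_nat R) e -natr1 ltrD2l.
Qed.

Lemma natrD_inj (a b : nat) (t u : R) : 0 < t < 1 -> 0 < u < 1 ->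
  a%:R + t = b%:R + u -> a = b.
Proof.
move=> /andP[t0 t1] /andP[u0 u1] e.
have [ab|ab|//] := ltngtP a b; move: ab; rewrite -(ler_nat R) -natr1 => ab.
  by have : False by lra.
by have : False by lra.
Qed.

Lemma wide_horizontal p q (u v : R * R) : strict p q -> wide p q -> (3 < size p)%N ->
  on_path p u -> on_path q v -> u.2 = v.2 ->
  0 < u.2 < (vertex p (size p)).2%:R -> 2 <= u.1 - v.1.
Proof.
move=> s w p3 /on_path_right hu /on_path_left hv e y.
have spq := strict_size s.
have far k l : (k <= size p)%N -> (l <= size p)%N -> (l.+2 <= k)%N ->
    (vertex p k).2 = (vertex q l).2 -> (2 : R) <= (vertex p k).1%:R - (vertex q l).1%:R.
  move=> kp lp lk ee; have Dp := vertexD p k; have Dq := vertexD q l.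
  rewrite lerBrDr -natrD ler_nat; move: Dp Dq; rewrite -spq; lia.
case: hu => [[k [kp uy ux]]|[k [t [pk t01 uy ux]]]]; case: hv =>
  [[l [lq vy vx]]|[l [t' [ql t01' vy vx]]]].
- have ee : (vertex p k).2 = (vertex q l).2 by apply/eqP;
  rewrite -(eqr_nat R) -uy -vy e.
  have lk : (l.+2 <= k)%N.
    by apply: (wide_far s w kp ee); move: y; rewrite uy ltr0n ltr_nat.
  have lp : (l <= size p)%N by rewrite spq.
  by have := far _ _ kp lp lk ee; lra.
- by case: (natr_between (a := (vertex p k).2) (b := (vertex q l).2) t01');
  rewrite -uy e.
- by case: (natr_between (a := (vertex q l).2) (b := (vertex p k).2) t01);
  rewrite -vy -e.
- have ee : (vertex p k).2 = (vertex q l).2.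
    by apply: (natrD_inj t01 t01'); rewrite -uy -vy.
  have kp := onth_size pk; have lq := onth_size ql; rewrite -spq in lq.
  by rewrite ux vx; apply: far;
    rewrite ?(ltnW kp) ?(ltnW lq) // (wide_far_step s w p3 pk ql).
Qed.

Variables (n : nat) (P Q : lpath n).
Hypothesis (s : strict P Q).

Lemma cell_lt i j : ((vertex Q (i + j).+1).1 <= i < (vertex P (i + j).+1).1)%N ->
  (i + j < n)%N.
Proof.
move=> /andP[h1 h2]; rewrite ltnNge; apply/negP => nc.
have endPQ := strict_end s; rewrite size_tuple in endPQ.
have eo (w : lpath n) : vertex w (i + j).+1 = vertex w n.
  by rewrite vertex_oversize size_tuple // leqW.
by move: h1 h2; rewrite !eo endPQ => h1; rewrite ltnNge h1.
Qed.

Lemma region_bounds (z : R * R) : region (P, Q) z ->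
  0 <= z.1 <= (vertex P n).1%:R /\ 0 <= z.2 <= (vertex P n).2%:R.
Proof.
move=> [[[i ni] [j nj]]]; rewrite (in_squares _ s) /= => h [/andP[x0 x1] /andP[y0 y1]].
have cn := cell_lt h; case/andP: h => h1 h2.
have endPQ := strict_end s; rewrite size_tuple in endPQ.
have hx : (i.+1 <= (vertex P n).1)%N by apply: leq_trans h2 _; apply: vertex1_mono.
have hy : (j.+1 <= (vertex P n).2)%N.
  rewrite endPQ; apply: leq_trans (vertex2_mono Q cn).
  have := vertexD Q (i + j).+1; rewrite size_tuple (minn_idPl cn).
  by move: h1; case: (vertex Q _) => a b /=; rewrite -addnS; lia.
move: hx hy; rewrite -!(ler_nat R) -!natr1 => hx hy.
have := ler0n R i; have := ler0n R j.
by split; apply/andP; split; lra.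
Qed.

Lemma cell_region i j (z : R * R) :
  ((vertex Q (i + j).+1).1 <= i < (vertex P (i + j).+1).1)%N ->
  i%:R <= z.1 <= i%:R + 1 -> j%:R <= z.2 <= j%:R + 1 -> region (P, Q) z.
Proof.
move=> h hx hy; have cn := cell_lt h.
have ni : (i < n)%N by lia.
have nj : (j < n)%N by lia.
by exists (Ordinal ni, Ordinal nj); rewrite // in_squares.
Qed.

Lemma interior_bounds (z : R * R) : interior (region (P, Q)) z ->
  0 < z.1 < (vertex P n).1%:R /\ 0 < z.2 < (vertex P n).2%:R.
Proof.
rewrite /interior /= => /nbhs_ballP[e /= e0 sub].
(* A small diagonal move in either direction stays in the region, so the weak bounds become
   strict. *)
have h (d : R) : `|d| < e ->
  0 <= z.1 + d <= (vertex P n).1%:R /\ 0 <= z.2 + d <= (vertex P n).2%:R.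
  move=> de; apply: (region_bounds (z := (z.1 + d, z.2 + d))); apply: sub.
  by split; rewrite /ball /= opprD addNKr normrN.
have [|/andP[a1 a2] /andP[a3 a4]] := h (e / 2); first by rewrite gtr0_norm; lra.
have [|/andP[b1 b2] /andP[b3 b4]] := h (- (e / 2));
  first by rewrite normrN gtr0_norm; lra.
by split; apply/andP; split; lra.
Qed.

Lemma box_interior (A : R * R -> Prop) (a b c d : R) (z : R * R) :
  (forall z', a < z'.1 < b -> c < z'.2 < d -> A z') ->
  a < z.1 < b -> c < z.2 < d -> interior A z.
Proof.
move=> sub /andP[z1 z2] /andP[z3 z4]; rewrite /interior /=.
exists ((fun x => is_true (a < x < b)) : classical_sets.set R,
  (fun y => is_true (c < y < d)) : classical_sets.set R);
  last by case=> x y /= [h1 h2]; apply: sub.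
split=> /=.
  by near=> x; apply/andP; split; near: x; [apply: lt_nbhsr|apply: lt_nbhsl].
by near=> x; apply/andP; split; near: x; [apply: lt_nbhsr|apply: lt_nbhsl].
Unshelve. all: by end_near.
Qed.

Lemma on_path_vertex (w : seq bool) k : (k < size w)%N ->
  on_path w ((vertex w k).1%:R : R, (vertex w k).2%:R : R).
Proof.
move=> /onth_lt[b hb]; exists k, 0; first by rewrite lexx ler01.
by case: b hb => hb; [right | left]; rewrite addr0.
Qed.

(** Where width fails, two vertices span a unit segment which is the common side of two cells of the
    diagram. Its inner points lie in the open box formed by these cells, so the segment contradicts
    thickness. *)
Lemma thick_wide : thick R P Q -> wide P Q.
Proof.
move=> [_ th] k k0; rewrite size_tuple => k1.
have kP : (k < size P)%N by rewrite size_tuple ltnW.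
have kQ : (k < size Q)%N by rewrite size_tuple ltnW.
have kP1 : (k.+1 < size P)%N by rewrite size_tuple.
have kQ1 : (k.+1 < size Q)%N by rewrite size_tuple.
have [|gx gy] := strict_gap (k := k) s; first by rewrite k0.
have [|gx1 gy1] := strict_gap (k := k.+1) s; first by [].
have Dp := vertexD P k; have Dp1 := vertexD P k.+1.
have Dq := vertexD Q k; have Dq1 := vertexD Q k.+1.
rewrite size_tuple (minn_idPl (ltnW (ltnW k1))) in Dp Dq.
rewrite size_tuple (minn_idPl (ltnW k1)) in Dp1 Dq1.
have [b hb] := onth_lt kP; have vb := vertexSr hb.
have [c hc] := onth_lt kQ; have vc := vertexSr hc.
have nb : (b <= 1)%N by case: (b).
have nc : (c <= 1)%N by case: (c).
rewrite ltnNge (ltnNge _.+1); split; apply/negP => le.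
(* Horizontal case: the segment from (x, j+1) to (x+1, j+1) separates the cells (x, j) and (x,
   j+1). *)
- have [j ej] : exists j, (vertex Q k).2 = j.+1.
    by exists (vertex Q k).2.-1; rewrite prednK //; apply: leq_ltn_trans gy.
  have ep : (vertex P k.+1).2 = j.+1 by rewrite vb /= in le *; lia.
  have [x ex] : exists x, (vertex Q k).1 = x by exists (vertex Q k).1.
  have ex1 : (vertex P k.+1).1 = x.+1 by lia.
  have ek : (x + j).+1 = k by lia.
  have ek1 : (x + j.+1).+1 = k.+1 by lia.
  have cell1 : ((vertex Q (x + j).+1).1 <= x < (vertex P (x + j).+1).1)%N.
    by rewrite ek ex leqnn /= -ex.
  have cell2 : ((vertex Q (x + j.+1).+1).1 <= x < (vertex P (x + j.+1).+1).1)%N.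
    by rewrite ek1 ex1 ltnSn andbT -ltnS -ex1.
  have [] := th _ _ (on_path_vertex kP1) (on_path_vertex kQ).
    rewrite ep ej ex ex1 => t /andP[t0 t1] /=.
    apply: (@box_interior _ x%:R (x%:R + 1) j%:R (j%:R + 2)) =>
      [z /andP[z1 z2] /andP[z3 z4]||] /=.
    + have [zj|zj] := lerP z.2 (j%:R + 1).
        by apply: (cell_region cell1); rewrite ?(ltW z1) ?(ltW z2) ?(ltW z3) ?zj.
      apply: (cell_region cell2); first by rewrite (ltW z1) (ltW z2).
      by rewrite -natr1; apply/andP; split; lra.
    + by rewrite -natr1; apply/andP; split; lra.
    + by rewrite -natr1; apply/andP; split; lra.
  rewrite ep ej ex ex1 /= => /(_ erefl) h _; move: h.
  by rewrite (_ : x.+1%:R - _ = 1) ?normr1; [lra | rewrite -natr1 addrAC subrr add0r].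
(* Vertical case: the segment from (i+1, y) to (i+1, y+1) separates the cells (i, y) and (i+1,
   y). *)
- have ey : (vertex Q k.+1).2 = (vertex P k).2.+1 by rewrite vc /= in le *; lia.
  have [y ey0] : exists y, (vertex P k).2 = y by exists (vertex P k).2.
  have [i ei] : exists i, (vertex P k).1 = i.+1.
    by exists (vertex P k).1.-1; rewrite prednK //; apply: leq_ltn_trans gx.
  have ei1 : (vertex Q k.+1).1 = i.+1 by lia.
  have ek : (i + y).+1 = k by lia.
  have ek1 : (i.+1 + y).+1 = k.+1 by lia.
  have cell1 : ((vertex Q (i + y).+1).1 <= i < (vertex P (i + y).+1).1)%N.
    by rewrite ek ei ltnSn andbT -ltnS -ei.
  have cell2 : ((vertex Q (i.+1 + y).+1).1 <= i.+1 < (vertex P (i.+1 + y).+1).1)%N.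
    by rewrite ek1 ei1 leqnn /= -ei1.
  have [] := th _ _ (on_path_vertex kP) (on_path_vertex kQ1).
    rewrite ey ey0 ei ei1 => t /andP[t0 t1] /=.
    apply: (@box_interior _ i%:R (i%:R + 2) y%:R (y%:R + 1)) =>
      [z /andP[z1 z2] /andP[z3 z4]||] /=.
    + have [zi|zi] := lerP z.1 (i%:R + 1).
        by apply: (cell_region cell1); rewrite ?(ltW z1) ?(ltW z3) ?(ltW z4) ?zi.
      apply: (cell_region cell2); last by rewrite (ltW z3) (ltW z4).
      by rewrite -natr1; apply/andP; split; lra.
    + by rewrite -natr1; apply/andP; split; lra.
    + by rewrite -natr1; apply/andP; split; lra.
  rewrite ey ey0 ei ei1 /= => _ /(_ erefl).
  by rewrite distrC (_ : y.+1%:R - _ = 1) ?normr1;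
    [lra | rewrite -natr1 addrAC subrr add0r].
Qed.

Lemma wide_thick : unmixed 0 P Q -> wide P Q -> (3 < n)%N -> thick R P Q.
Proof.
move=> um w n3; split; first by apply/asboolP; rewrite non_mixed_unmixed.
move=> u v uP vQ ti.
(* The midpoint is interior, which keeps the line of the segment strictly inside the bounding
   box. *)
have half : ((0 : R) < 1 / 2) && ((1 : R) / 2 < 1) by apply/andP; split; lra.
have [/= bx byy] := interior_bounds (ti _ half).
have spq : size P = size Q by rewrite !size_tuple.
split=> e.
  apply: le_trans (ler_norm _); apply: (wide_horizontal s w) => //.
    by rewrite size_tuple.
  by rewrite size_tuple; move: byy; rewrite e subrr mulr0 addr0.
rewrite distrC; apply: le_trans (ler_norm _).
apply: (@wide_horizontal (flip Q) (flip P) (v.2, v.1) (u.2, u.1)) => //=.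
- by rewrite strict_flip.
- exact: wide_flip.
- by rewrite size_flip size_tuple.
- exact: on_path_flip.
- exact: on_path_flip.
rewrite size_flip size_tuple vertex_flip /= -[n in vertex Q n](size_tuple P) -(strict_end s) size_tuple.
by move: bx; rewrite e subrr mulr0 addr0.
Qed.

End Geometry.

Lemma thickE (R : realType) n (P Q : lpath n) : 3 < n ->
  strictly_below P Q && `[< thick R P Q >] =
  `[< [/\ strict P Q, unmixed 0 P Q & wide P Q] >].
Proof.
move=> n3; rewrite strictly_below_strict; last exact: ltn_trans n3.
apply/andP/asboolP => [[s /asboolP th]|[s u w]].
  by split=> //; [case: th => nm _; rewrite -non_mixed_unmixed;
    apply/asboolP | exact: thick_wide th].
by split=> //; apply/asboolP; apply: wide_thick.
Qed.

(** * Connectedness *)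

Lemma size_north_steps (w : seq bool) a m :
  size [seq k <- iota a m | onth w k == Some N] = count_mem N (take m (drop a w)).
Proof.
elim: m a => [|m IHm] a; first by rewrite take0.
rewrite /= fun_if /= IHm; have [aw|wa] := ltnP a (size w); last first.
  by rewrite onth_default // !drop_oversize //= ltnW.
rewrite (drop_nth N aw) /=; have -> : onth w a = Some (nth N w a).
  by rewrite onthE (nth_map N).
by case: (nth N w a).
Qed.

(** Translates positions of north steps into heights of vertices, where the two paths can be
    compared. *)
Lemma north_step_lt n w i k : k <= n ->
  i < (vertex w n).2 -> (@north_step n w i < k) = (i < (vertex w k).2).
Proof.
rewrite !vertex2E => kn iw; rewrite /north_step.
have -> : iota 0 n = iota 0 k ++ iota k (n - k) by rewrite -iotaD subnKC.
rewrite filter_cat nth_cat size_north_steps drop0;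
  case: (ltnP i (count_mem N (take k w))) => ik.
  set t := seq.filter _ _; have: nth n t i \in t.
    by apply: mem_nth; rewrite size_north_steps drop0.
  by rewrite mem_filter mem_iota => /and3P[].
apply/negbTE; rewrite -leqNgt.
set t := seq.filter _ _; set j := i - _; have: nth n t j \in t.
  apply: mem_nth; rewrite size_north_steps /j; move: iw.
  by rewrite -{1}(subnKC kn) takeD count_cat; lia.
by rewrite mem_filter mem_iota => /and3P[].
Qed.

Lemma north_step_mono n w i j : i < j < (vertex w n).2 ->
  @north_step n w i < @north_step n w j.
Proof.
move=> /andP[ij jw]; have jn : @north_step n w j < n by rewrite north_step_lt.
rewrite (north_step_lt (ltnW jn) (ltn_trans ij jw)); apply: (leq_trans ij).
have : j < (vertex w (@north_step n w j).+1).2 by rewrite -(north_step_lt jn jw).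
rewrite !vertex2E -[(@north_step n w j).+1]addn1 takeD count_cat => h.
have le1 u : count_mem N (take 1 u) <= 1.
  by apply: leq_trans (count_size _ _) _; rewrite size_take_min geq_minl.
rewrite -ltnS; apply: (leq_trans h); rewrite -[X in _ <= X]addn1; exact: leq_add.
Qed.

Section Connected.
Variables (n : nat) (P Q : lpath n).
Hypotheses (n1 : 1 < n) (s : strict P Q).

Let r := (vertex P n).2.

Let rQ : (vertex Q n).2 = r.
Proof. by have := strict_end s; rewrite size_tuple /r => ->. Qed.

Let le_PQ k : k <= n -> (vertex P k).2 <= (vertex Q k).2.
Proof.
case: (posnP k) => [->|k0]; first by rewrite !vertex0.
rewrite leq_eqVlt => /predU1P[->|kn]; first by rewrite rQ.
by have [|_ /ltnW] := strict_gap (k := k) s; rewrite ?k0 ?size_tuple.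
Qed.

Lemma north_step_le i : i < r -> @north_step n Q i <= @north_step n P i.
Proof.
move=> ir; have Pn : @north_step n P i < n by rewrite north_step_lt.
rewrite -ltnS north_step_lt ?rQ //; apply: leq_trans (le_PQ Pn).
by rewrite -(north_step_lt Pn ir).
Qed.

Lemma transversal_in_lpm (g : 'I_r -> 'I_n) (A : {set 'I_r}) : injective g ->
  (forall i, g i \in north_interval P Q i) -> g @: A \in lpm P Q.
Proof.
move=> gI gN; rewrite inE; apply/asboolP.
(* The inverse of [g] on its image; the value 0 elsewhere is irrelevant. *)
exists (fun k => odflt 0 (omap val [pick i | g i == k])).
have fg i : odflt 0 (omap val [pick j | g j == g i]) = i.
  case: pickP => [j /eqP/gI->|/(_ i)] //=; by rewrite eqxx.
split=> [_ _ /imsetP[i _ ->] /imsetP[j _ ->]|_ /imsetP[i _ ->]].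
  by rewrite !fg => /val_inj->.
by rewrite fg.
Qed.

Lemma card_lpm X : X \in lpm P Q -> #|X| <= r.
Proof.
rewrite inE => /asboolP[f [fI fr]].
case: (set_0Vmem X) => [->|[x0 x0X]]; first by rewrite cards0.
have r0 : 0 < r by case: (fr _ x0X) => + _; apply: leq_ltn_trans.
pose h k : 'I_r := insubd (Ordinal r0) (f k).
rewrite -[r]card_ord -(@card_in_imset _ _ h) ?max_card // => x y xX yX.
move=> /(congr1 val); rewrite !val_insubd.
by case: (fr _ xX) (fr _ yX) => -> _ [-> _]; apply: fI.
Qed.

(* The unit square between positions k and k+1 lets one exchange k for k+1 in
   a basis; all other elements are taken as early as possible below this
   square and as late as possible above it. *)
Lemma exchange_basis (k k' : 'I_n) : k' = k.+1 :> nat ->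
  exists X : {set 'I_n}, [/\ k \notin X, k' \notin X, k |: X \in lpm P Q,
    k' |: X \in lpm P Q & k' |: (k |: X) \notin lpm P Q].
Proof.
(* Before [k'] the path [P] has made [y] north steps and [Q] more than [y]. Hence both [k] and [k']
   lie in the interval of index [y], whose representative is exchanged. *)
move=> kk; pose y := (vertex P k').2.
have k'n := ltn_ord k'.
have [|_ gap] := strict_gap (k := k') s; first by rewrite size_tuple {1}kk k'n.
rewrite -/y in gap.
have yr : y < r by rewrite -rQ; apply: leq_trans gap _; apply/vertex2_mono/ltnW.
pose yo := Ordinal yr.
have Qy : @north_step n Q y <= k.
  by rewrite -ltnS -kk north_step_lt ?rQ // ltnW.
have Py : k' <= @north_step n P y by rewrite leqNgt north_step_lt ?ltnn // ltnW.
pose g (e : 'I_n) (i : 'I_r) : 'I_n := insubd e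
  (if i < y then @north_step n Q i else if i == yo then e : nat else @north_step n P i).
have Qn (i : 'I_r) : @north_step n Q i < n by rewrite north_step_lt ?rQ.
have Pn (i : 'I_r) : @north_step n P i < n by rewrite north_step_lt.
have gE e i : g e i =
  (if i < y then @north_step n Q i else if i == yo then e : nat else @north_step n P i) :> nat.
  by rewrite [LHS]val_insubd; case: ifP => //; case: ifP => [_|_]; rewrite ?Qn //;
    case: ifP; rewrite ?ltn_ord ?Pn.
have gQ e (i : 'I_r) : i < y -> g e i = @north_step n Q i :> nat.
  by move=> iy; rewrite gE iy.
have gP e (i : 'I_r) : y < i -> g e i = @north_step n P i :> nat.
  move=> yi; rewrite gE (leq_gtF (ltnW yi)) ifN //.
  by apply/eqP => iy; rewrite iy ltnn in yi.
have glt e (i : 'I_r) : i < y -> g e i < k.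
  move=> iy; rewrite gQ //; apply: leq_trans Qy.
  by apply: north_step_mono; rewrite iy rQ.
have ggt e (i : 'I_r) : y < i -> k' < g e i.
  move=> yi; rewrite gP //; apply: (leq_ltn_trans Py).
  by apply: north_step_mono; rewrite yi /=.
have gy e : g e yo = e by apply: val_inj; rewrite [LHS]gE /= ltnn eqxx.
have gne e i : i != yo -> g e i = g k i.
  by move=> /negbTE iy; apply: val_inj; rewrite [LHS]gE [RHS]gE iy.
have gmono e : e = k \/ e = k' -> {homo g e : i j / (i : nat) < j}.
  move=> ek i j ij; have [iy|yi|iy] := ltngtP i y.
  - have [jy|yj|jy] := ltngtP j y.
    + by rewrite !gQ //; apply: north_step_mono; rewrite ij rQ /=.
    + by apply: ltn_trans (glt _ _ iy) (ltn_trans _ (ggt _ _ yj)); rewrite kk.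
    + have -> : j = yo by apply: val_inj.
      rewrite gy; apply: leq_trans (glt _ _ iy) _.
      by case: ek => -> //; rewrite kk.
  - have yj := ltn_trans yi ij.
    by rewrite !gP //; apply: north_step_mono; rewrite ij /=.
  - have -> : i = yo by apply: val_inj.
    rewrite gy; apply: leq_ltn_trans (ggt _ _ _); last by rewrite -iy.
    by case: ek => ->; rewrite ?kk.
have gI e : e = k \/ e = k' -> injective (g e).
  move=> /gmono m i j e1; have [/m|/m|/val_inj//] := ltngtP i j; by rewrite e1 ltnn.
have gN e : e = k \/ e = k' -> forall i, g e i \in north_interval P Q i.
  move=> ek i; rewrite inE gE; have [iy|yi] := ltnP i y.
    by rewrite leqnn north_step_le.
  case: eqP => [->|_] /=; last by rewrite leqnn north_step_le.
  by case: ek => ->;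
    [rewrite Qy (leq_trans _ Py) // kk | rewrite Py (leq_trans Qy) // kk].
pose X := g k @: (~: [set yo]).
have gX e : e |: X = g e @: [set: 'I_r].
  rewrite -(setUCr [set yo]) imsetU imset_set1 gy; congr (_ |: _).
  by apply: eq_in_imset => i; rewrite !inE => /gne.
have kX : k \notin X.
  apply/imsetP => -[i]; rewrite !inE => iy /(congr1 val) /= e.
  have [h|h|h] := ltngtP i y.
  - by have := glt k _ h; rewrite -e ltnn.
  - by have := ggt k _ h; rewrite -e kk ltnNge leqnSn.
  - by move: iy; rewrite -val_eqE /= h eqxx.
have k'X : k' \notin X.
  apply/imsetP => -[i]; rewrite !inE => iy /(congr1 val) /= e.
  have [h|h|h] := ltngtP i y.
  - by have := glt k _ h; rewrite -e kk ltnNge leqnSn.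
  - by have := ggt k _ h; rewrite -e ltnn.
  - by move: iy; rewrite -val_eqE /= h eqxx.
exists X; split=> //.
- by rewrite gX transversal_in_lpm //; [apply: gI; left | apply: gN; left].
- by rewrite gX transversal_in_lpm //; [apply: gI; right | apply: gN; right].
(* The set has [r + 1] elements, one more than an independent set can have. *)
apply/negP => /card_lpm; rewrite cardsU1 in_setU1 negb_or k'X andbT.
rewrite -val_eqE /= kk gtn_eqF //= gX card_imset; last by apply: gI; left.
by rewrite cardsT card_ord ltnn.
Qed.

(** If a separator [A] contained just one of [k], [k+1], the independent parts of [k |: X] and
    [k' |: X] on the two sides would combine to make the union independent. So membership in [A] is
    constant along the ground set, and [A] or its complement is empty. *)
Lemma lpm_connected : matroid_connected (lpm P Q).
Proof.
move=> [A [A0 AC0 sep]].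
have adj (k k' : 'I_n) : k' = k.+1 :> nat -> (k \in A) = (k' \in A).
  move=> kk; have [X [kX k'X Xk Xk' Xkk]] := exchange_basis kk.
  rewrite sep in Xk; rewrite sep in Xk'; rewrite sep in Xkk.
  case/andP: Xk => a1 a2; case/andP: Xk' => b1 b2.
  have [kA|kA] := boolP (k \in A); have [k'A|k'A] := boolP (k' \in A) => //.
  - case/negP: Xkk; apply/andP; split.
      rewrite (_ : _ :&: A = (k |: X) :&: A) //; apply/setP => x; rewrite !inE.
      by case: (eqVneq x k') => [->|]//=; rewrite (negbTE k'A) !andbF.
    rewrite (_ : _ :\: A = (k' |: X) :\: A) //; apply/setP => x; rewrite !inE.
    by case: (eqVneq x k) => [->|]//=; rewrite kA.
  - case/negP: Xkk; apply/andP; split.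
      rewrite (_ : _ :&: A = (k' |: X) :&: A) //; apply/setP => x; rewrite !inE.
      by case: (eqVneq x k) => [->|]//=; rewrite (negbTE kA) !andbF.
    rewrite (_ : _ :\: A = (k |: X) :\: A) //; apply/setP => x; rewrite !inE.
    by case: (eqVneq x k') => [->|]//=; rewrite k'A.
have n0 := ltnW n1.
have all k : (k \in A) = (Ordinal n0 \in A).
  case: k => k; elim: k => [|k IHk] kn; first by congr (_ \in A); apply: val_inj.
  by rewrite -(IHk (ltnW kn)); symmetry; apply: adj.
have [z|z] := boolP (Ordinal n0 \in A).
  by move/set0Pn: AC0 => [x]; rewrite inE all z.
by move/set0Pn: A0 => [x]; rewrite all (negbTE z).
Qed.

End Connected.

Theorem theorem5p4 (R : realType) :
  [/\ forall m : nat, 3 <= m -> #|thick_diagrams R m| = pell (m - 2),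
      forall m : nat, 1 <= m ->
        #|non_mixed_diagrams m| = (3 ^ (m - 1) + 1) %/ 2
    & forall n : nat, 2 <= n ->
        (forall P Q : n.-tuple bool, meet_only_at_ends P Q ->
           matroid_connected (lpm P Q)) /\
        #|non_mixed_path_pairs n| = (3 ^ (n - 2) + 1) %/ 2].
Proof.
have cnt0 k : cnt k.+2 (admissible 0) = (3 ^ k + 1) %/ 2.
  by rewrite -cnt_admissible0 -muln2 mulnK.
split.
(* Size [m + 3] means paths of length [m + 4], which peeling shortens to [m + 2]. *)
- move=> [|[|[|m]]] // _; rewrite subn2 [_.-2]/= -cnt_admissible1 -cnt_wide //.
  rewrite -(@card_diagrams m.+4) //; last by move=> p q /asboolP[].
  rewrite /thick_diagrams; set A := finset _; set B := finset _.
  by have -> : A = B by apply/setP => PQ; rewrite !inE thickE.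
- move=> [|m] // _; rewrite subn1 /= -cnt0 -(@card_diagrams m.+2) //.
    by rewrite /non_mixed_diagrams non_mixed_pairsE.
  by move=> p q /andP[].
- move=> [|[|n]] // _; split=> [P Q|].
    by rewrite meet_only_at_ends_strict // => s; apply: lpm_connected.
  rewrite subn2 /= -cnt0; apply: eq_card => PQ.
  by rewrite !inE meet_only_at_ends_strict // non_mixed_unmixed.
Qed.
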